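(* Let $p_{N,M}^{\rm r}$ denote the probability that a random matrix from the $N\times N$ real spherical ensemble has exactly $M$ real eigenvalues, and let $E_\alpha$ denote the minimum electrostatic energy on the sphere defined in the context. Let $\alpha\in(0,1]$ be fixed, and let $N\to\infty$ through those positive integers for which $M:=\alpha N$ is an integer of the same parity as $N$. Assume the electrostatics hypothesis, i.e. that along this sequence $$\lim_{N\to\infty}\Big(-\frac{1}{N^2}\log p_{N,M}^{\rm r}\Big)\Big|_{M=\alpha N}=E_\alpha .$$ Then, as $N\to\infty$ with $M/N=\alpha$, $$\log p_{N,M}^{\rm r}\sim-\frac{N^2}{8}\bigg(-2\alpha+(\alpha-1)\Big((1-\alpha)\log(1-\alpha)-(\alpha+1)\log(1+\alpha)\Big)+2\alpha(\alpha+1)\log(1+\alpha)\bigg),$$ meaning that the ratio of the two sides tends to $1$. For $\alpha=1$ the right-hand side is interpreted as its limit as $\alpha\to1^-$ (i.e. $(1-\alpha)\log(1-\alpha)$ is read as $0$).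
   Context: The real spherical ensemble consists of the random $N\times N$ matrices $AB^{-1}$, where $A,B$ are independent $N\times N$ matrices whose entries are independent standard real Gaussians. Non-real eigenvalues come in complex conjugate pairs, so the number $M$ of real eigenvalues has the same parity as $N$. Definition of $E_\alpha$. Let $S\subset\mathbb R^3$ be the sphere of radius $1/2$ centred at the origin (surface area $\pi$), with equator $C$ (length $\pi$) and surface area measure $dA$. The Coulomb pair potential between unit charges at $\vec r,\vec r\,'\in S$ is $-\log\|\vec r-\vec r\,'\|$. A charge configuration is a pair of non-negative measures $(\nu_{\rm e},\nu_{\rm b})$, where $\nu_{\rm e}$ is supported on $C$ with total charge $\nu_{\rm e}(C)=\alpha$, and $\nu_{\rm b}$ is a measure on $S$ (charge on the body of the sphere), symmetric under reflection in the plane of the equator, with total charge $\nu_{\rm b}(S)=1-\alpha$. There is also a neutralising uniform background of charge density $-1/\pi$ on $S$. The total signed charge is $\sigma=\nu_{\rm e}+\nu_{\rm b}-\frac1\pi\,dA$, and the electrostatic energy is $$\mathcal E(\nu_{\rm e},\nu_{\rm b})=-\frac12\int_S\int_S\log\|\vec r-\vec r\,'\|\,d\sigma(\vec r)\,d\sigma(\vec r\,').$$ $E_\alpha$ is the minimum of $\mathcal E(\nu_{\rm e},\nu_{\rm b})$ over all such configurations (of finite energy). *)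

(* Defs.v *)
From HB Require Import structures.
From mathcomp Require Import all_boot all_order all_algebra.
From mathcomp Require Import all_classical all_reals all_analysis.
From mathcomp Require Import measurable_realfun polyrcf.
Set Implicit Arguments.
Unset Strict Implicit.
Unset Printing Implicit Defensive.
Import Order.TTheory GRing.Theory Num.Theory.
Import numFieldNormedType.Exports.

Local Open Scope classical_set_scope.
Local Open Scope ring_scope.

Section RandomMatrices.
Context {R : realType} {d : measure_display} {T : measurableType d}.
Variable P : probability T R.

(* Taking some of the U i to be setT gives the product rule for every
   subfamily. *)
Definition mutually_independent (I : finType) (Z : I -> {RV P >-> R}) :=
  forall U : I -> set R, (forall i, measurable (U i)) ->
    P (\bigcap_(i in [set: I]) Z i @^-1` U i) =
    (\prod_(i : I) P (Z i @^-1` U i))%E.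

Definition standard_gaussian (Z : {RV P >-> R}) :=
  forall U : set R, measurable U -> distribution P Z U = normal_prob 0 1 U.

Definition real_spherical_ensemble (N : nat) (X : T -> 'M[R]_N) :=
  exists G : bool * 'I_N * 'I_N -> {RV P >-> R},
    [/\ forall i, standard_gaussian (G i),
        mutually_independent G &
        forall w, let A := \matrix_(i, j) G (false, i, j) w in
                  let B := \matrix_(i, j) G (true, i, j) w in
                  (* [invmx B] is a junk value only for singular B, that is,
                     on an event of probability zero *)
                  X w = A *m invmx B].

(* Real eigenvalues are counted with algebraic multiplicity. *)
Definition num_real_eigenvalues (N : nat) (A : 'M[R]_N) : nat :=
  (\sum_(x <- rootsR (char_poly A)) mup x (char_poly A))%N.

Definition prob_real_eigenvalues (N : nat) (X : T -> 'M[R]_N) (M : nat) : R :=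
  fine (P [set w | num_real_eigenvalues (X w) = M]).

End RandomMatrices.

Section SphereGeometry.
Context {R : realType}.

(* Euclidean 3-space, with the product (= Borel) sigma-algebra; the library's
   norm on products is the sup norm, hence the explicit distance. *)
Definition space3 : measurableType _ := (R * R * R)%type.

Definition euclid_dist (r s : space3) : R :=
  Num.sqrt ((r.1.1 - s.1.1) ^+ 2 + (r.1.2 - s.1.2) ^+ 2 + (r.2 - s.2) ^+ 2).

Definition sphere : set space3 := [set r | euclid_dist r (0, 0, 0) = 2^-1].

Definition equator : set space3 := sphere `&` [set r | r.2 = 0].

Definition reflect_equator (r : space3) : space3 := (r.1.1, r.1.2, - r.2).

(* Azimuth u.1, polar angle u.2. *)
Definition sphere_point (u : R * R) : space3 :=
  (2^-1 * (sin u.2 * cos u.1), 2^-1 * (sin u.2 * sin u.1), 2^-1 * cos u.2).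

Definition angles : set (R * R) := `[0, 2 * pi] `*` `[0, pi].

Lemma measurable_sphere_point : measurable_fun setT sphere_point.
Proof.
have mc : measurable_fun setT (@cos R).
  by apply: continuous_measurable_fun => x; exact: continuous_cos.
have ms : measurable_fun setT (@sin R).
  by apply: continuous_measurable_fun => x; exact: continuous_sin.
have m1 : measurable_fun setT (fst : R * R -> R) by [].
have m2 : measurable_fun setT (snd : R * R -> R) by [].
apply: measurable_fun_pair; first apply: measurable_fun_pair.
- apply: measurable_funM => //.
  by apply: measurable_funM; apply: measurableT_comp.
- apply: measurable_funM => //.
  by apply: measurable_funM; apply: measurableT_comp.
- by apply: measurable_funM => //; apply: measurableT_comp.
Qed.

Lemma measurable_angles : measurable angles.
Proof. by apply: measurableX. Qed.

Definition sphere_area (U : set space3) : \bar R :=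
  (\int[lebesgue_measure \x lebesgue_measure]_(u in
      angles `&` sphere_point @^-1` U) (2^-1 ^+ 2 * sin u.2)%:E)%E.

Let sphere_area0 : sphere_area set0 = 0%E.
Proof. by rewrite /sphere_area preimage_set0 setI0 integral_set0. Qed.

Let area_element_ge0 u : angles u -> (0 <= (2^-1 ^+ 2 * sin u.2 : R)%:E)%E.
Proof.
move=> [_ /=]; rewrite in_itv/= => u2.
by rewrite lee_fin mulr_ge0// ?exprn_ge0// ?invr_ge0// sin_ge0_pi.
Qed.

Let sphere_area_ge0 U : (0 <= sphere_area U)%E.
Proof. by apply: integral_ge0 => u [/area_element_ge0]. Qed.

Let sphere_area_sigma_additive : semi_sigma_additive sphere_area.
Proof.
move=> F mF tF mUF; rewrite /sphere_area preimage_bigcup setI_bigcupr.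
rewrite ge0_integral_bigcup//=.
- apply: is_cvg_ereal_nneg_natsum_cond => n _ _.
  by apply: integral_ge0 => u [/area_element_ge0].
- move=> n; apply: measurableI; first exact: measurable_angles.
  by rewrite -[X in measurable X]setTI; exact: measurable_sphere_point.
- apply: measurable_funTS; apply/measurable_EFinP.
  apply: measurable_funM => //; apply: measurableT_comp => //.
  by apply: continuous_measurable_fun => x; exact: continuous_sin.
- by move=> u [n _ [/area_element_ge0]].
- move=> i j _ _ [u [[_ Fi] [_ Fj]]]; apply: tF => //.
  by exists (sphere_point u).
Qed.

HB.instance Definition _ := isMeasure.Build _ _ _ sphere_area
  sphere_area0 sphere_area_ge0 sphere_area_sigma_additive.

End SphereGeometry.
Arguments space3 R : clear implicits.

Section Electrostatics.
Context {R : realType}.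

Lemma pi_inv_ge0 : 0 <= (pi : R)^-1.
Proof. by rewrite invr_ge0 pi_ge0. Qed.

(* The opposite of the neutralising background charge. *)
Definition background : {measure set space3 R -> \bar R} :=
  mscale (NngNum pi_inv_ge0) sphere_area.

(* [lne 0 = -oo], so this is +oo at coincident points. *)
Definition coulomb (r s : space3 R) : \bar R := (- lne (euclid_dist r s)%:E)%E.

Definition interaction (mu nu : {measure set space3 R -> \bar R}) : \bar R :=
  (\int[mu]_(r in sphere) \int[nu]_(s in sphere) coulomb r s)%E.

(* The double integral against nu_e + nu_b - background, expanded bilinearly.
   The sphere has diameter 1, so coulomb is nonnegative on it and every term
   makes sense; only the first one can be infinite. *)
Definition energy (nu_e nu_b : {measure set space3 R -> \bar R}) : \bar R :=
  let nu : {measure set space3 R -> \bar R} := measure_add nu_e nu_b in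
  ((2^-1)%:E * (interaction nu nu - interaction nu background
                - interaction background nu
                + interaction background background))%E.

Definition charge_configuration (alpha : R)
    (nu_e nu_b : {finite_measure set space3 R -> \bar R}) :=
  [/\ nu_e (~` equator) = 0%E, nu_e equator = alpha%:E,
      nu_b (~` sphere) = 0%E, nu_b sphere = (1 - alpha)%:E &
      forall U, measurable U -> nu_b (reflect_equator @^-1` U) = nu_b U].

Definition finite_energies (alpha : R) : set R :=
  [set e | exists nu_e nu_b : {finite_measure set space3 R -> \bar R},
     charge_configuration alpha nu_e nu_b /\ energy nu_e nu_b = e%:E].

(* The least element of finite_energies alpha; 0 is a default value. *)
Definition min_energy (alpha : R) : R :=
  xget 0 (finite_energies alpha `&` lbound (finite_energies alpha)).

End Electrostatics.

Definition admissible (R : realType) (alpha : R) : set nat :=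
  [set N | (0 < N)%N /\
           exists2 M : nat, M%:R = alpha * N%:R & odd M = odd N].

(* Main.v *)
(* On the sphere of radius 1/2, [-ln |r - s|] is a power series with positive
   coefficients in [1 - |r - s|^2 = 1/2 + 2 <r, s>], hence a positive definite
   kernel: its bilinear form K satisfies 2 K(nu, nu0) <= K(nu, nu) + K(nu0, nu0).
   The background has constant potential 1/2, so minimising the energy of a
   configuration nu amounts to minimising K(nu, nu).  Let nu0 be the uniform
   charge alpha on the equator plus the background restricted to the two polar
   caps |2 z| >= alpha.  By Gauss' law its potential is constant on the caps; it
   is at least as large everywhere else on the sphere (Gibbs' inequality), and
   it is constant on the equator.  Hence K(nu, nu0) >= K(nu0, nu0) for every
   configuration nu, which makes nu0 a minimiser of K(nu, nu).  The potential of
   nu0 is explicit because the mean of [ln |e^(ix) - w|] over the unit circle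
   vanishes for |w| <= 1, by the doubling |e^(ix) - w| |e^(ix) + w| =
   |e^(2ix) - w^2|. *)
Require Import Defs.
From HB Require Import structures.
From mathcomp Require Import all_boot all_order all_algebra.
From mathcomp Require Import all_classical all_reals all_analysis.
From mathcomp Require Import measurable_realfun ring lra.
Set Implicit Arguments.
Unset Strict Implicit.
Unset Printing Implicit Defensive.
Import Order.TTheory GRing.Theory Num.Theory.
Import numFieldNormedType.Exports.
Local Open Scope classical_set_scope.
Local Open Scope ring_scope.

(** * Logarithms and polar integrals *)

(** The latitude |2 z| = alpha comes from neutrality: area on a sphere is proportional to height, so
    the belt |2 z| < alpha carries the background charge -alpha, which the charge alpha on the
    equator compensates exactly.

    Because the charge on the equator is prescribed, the potential of nu0 may take different values
    on the equator and on the caps: nu_e is tested against the first value and nu_b against the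
    second. The chain 2 K(nu0, nu0) <= 2 K(nu, nu0) <= K(nu, nu) + K(nu0, nu0) then gives the bound,
    since K(nu0, nu0) is finite and can be cancelled.

    The obstacle is that K(nu, nu) may be infinite and the kernel is singular on the diagonal. Since
    the kernel is nonnegative, its power series can be integrated term by term, and each term is a
    finite sum of products of moments; symmetry and positive definiteness are checked on these
    terms, without subtracting infinite quantities.

    The asymptotic ratio also requires the minimum to be nonzero; it is at least alpha^4/16. *)

Section LogFacts.
Context {R : realType}.
Implicit Types x y p q : R.

Lemma ln_le_sub1 x : 0 < x -> ln x <= x - 1.
Proof.
move=> x0; have := @le_ln1Dx R (x - 1).
by rewrite (addrC 1) subrK; apply; lra.
Qed.

(** The termwise form of Gibbs' inequality: summed over two probability vectors, the left-hand sides
    cancel. The case p = 0 is covered because [0 * ln 0] is 0. *)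
Lemma gibbs_inequality p q : 0 <= p -> 0 < q -> p - q <= p * ln p - p * ln q.
Proof.
rewrite le_eqVlt => /predU1P[<-|p0] q0; first by rewrite !mul0r; lra.
have := @ln_le_sub1 (q / p) (divr_gt0 q0 p0).
rewrite ln_div// -(ler_pM2l p0) !mulrBr mulr1 mulrCA divff ?gt_eqF// mulr1.
lra.
Qed.

Lemma is_derive_congr (f g : R -> R) x a b :
  is_derive x 1 f a -> f =1 g -> a = b -> is_derive x 1 g b.
Proof. by move=> fa /funext <- <-. Qed.

Lemma is_derive_log_partial_sum n x :
  is_derive x 1 (fun y => \sum_(k < n) y ^+ k.+1 / k.+1%:R) (\sum_(k < n) x ^+ k).
Proof.
elim: n => [|n IHn].
  by under eq_fun do rewrite big_ord0; rewrite big_ord0; exact: is_derive_cst.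
under eq_fun do rewrite big_ord_recr/=.
rewrite big_ord_recr/=; apply: is_deriveD => //.
apply: (@is_derive_congr (id ^+ n.+1 * cst n.+1%:R^-1)).
- by move=> z; rewrite !fctE.
- rewrite scaler0 add0r /cst /GRing.scale/= mulr1 mulrA mulVf ?mul1r//.
Qed.

(** By the geometric sum, the remainder has derivative z^n / (1 - z) and vanishes at 0; the mean
    value theorem bounds it on both sides. The upper bound gives convergence of the series, the
    lower one the positivity of the minimum energy. *)
Lemma ln_partial_sum_bounds n y : 0 <= y -> y < 1 ->
  0 <= - ln (1 - y) - \sum_(k < n) y ^+ k.+1 / k.+1%:R <= y ^+ n * (y / (1 - y)).
Proof.
move=> y0 y1.
pose f z : R := - ln (1 - z) - \sum_(k < n) z ^+ k.+1 / k.+1%:R.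
pose df z : R := (1 - z)^-1 - \sum_(k < n) z ^+ k.
have fd (z : R) : z < 1 -> is_derive z 1 f (df z).
  move=> z1; apply: is_deriveB; last exact: is_derive_log_partial_sum.
  have H : is_derive (1 - z) 1 (@ln R) (1 - z)^-1 by apply: is_derive1_ln; lra.
  have H2 : is_derive z 1 (fun z : R => 1 - z) (-1).
    apply: (@is_derive_congr (cst 1 - id)); first by move=> t; rewrite !fctE.
    by rewrite sub0r.
  have H3 := is_deriveN (@is_derive1_comp _ (@ln R) (fun z : R => 1 - z) _ _ _ H H2).
  apply: (is_derive_congr H3); first by move=> t; rewrite !fctE.
  by rewrite mulrN1 opprK.
have [c|c|c c0y] := @MVT_segment R f df 0 y y0.
- by rewrite in_itv/= => /andP[_ cy]; apply: fd; lra.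
- move: c; apply: derivable_within_continuous => c.
  rewrite in_itv/= => /andP[_ cy].
  by have := fd c (le_lt_trans cy y1) => -[].
have f0 : f 0 = 0.
  rewrite /f subr0 ln1 oppr0 sub0r big1 ?oppr0// => i _.
  by rewrite expr0n mul0r.
rewrite -/(f y) f0 !subr0 => ->.
move: c0y; rewrite in_itv/= => /andP[c0 cy].
have c1 : 0 < 1 - c by lra.
have -> : df c = c ^+ n / (1 - c).
  rewrite /df; apply: (mulIf (lt0r_neq0 c1)).
  rewrite mulrBl mulVf ?gt_eqF// divfK ?gt_eqF//.
  have := subrX1 c n; set S := \sum_(_ < _) _ => h.
  have -> : S * (1 - c) = - ((c - 1) * S) by ring.
  by rewrite -h; ring.
apply/andP; split.
  by rewrite mulr_ge0// divr_ge0// ?exprn_ge0// ltW.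
rewrite [leRHS]mulrCA [leLHS]mulrC ler_wpM2l//.
rewrite ler_pM ?exprn_ge0 ?invr_ge0 ?(ltW c1)//.
  by rewrite lerXn2r// nnegrE.
by rewrite lef_pV2 ?posrE//; lra.
Qed.

Lemma cvg_log_series y : 0 <= y -> y < 1 ->
  (fun n => \sum_(0 <= k < n) y ^+ k.+1 / k.+1%:R) @ \oo --> - ln (1 - y).
Proof.
move=> y0 y1.
apply: (@squeeze_cvgr _ _ _ _ (fun n => - ln (1 - y) - y ^+ n * (y / (1 - y)))
   (fun=> - ln (1 - y))).
- near=> n; rewrite big_mkord.
  by have /andP[? ?] := ln_partial_sum_bounds n y0 y1; apply/andP; split; lra.
- rewrite -[X in _ --> X]subr0; apply: cvgB; first exact: cvg_cst.
  rewrite -[X in _ --> X](mul0r (y / (1 - y))); apply: cvgMl.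
  by apply: cvg_expr; rewrite ger0_norm.
- exact: cvg_cst.
Unshelve. all: by end_near. Qed.

(** The endpoint y = 1 is the kernel at coincident points: there the harmonic series diverges, in
    agreement with [lne 0 = -oo]. *)
Lemma lne_series y : 0 <= y -> y <= 1 ->
  (\sum_(0 <= k <oo) (y ^+ k.+1 / k.+1%:R)%:E = - lne (1 - y)%:E)%E.
Proof.
move=> y0; rewrite le_eqVlt => /predU1P[->|y1]; last first.
  rewrite lne_EFin ?subr_gt0// -EFinN; apply/cvg_lim => //.
  under eq_fun do rewrite sumEFin.
  by apply: cvg_EFin; [exact: nearW|exact: cvg_log_series].
rewrite subrr le0_lneNy// /=.
under eq_eseriesr do rewrite expr1n div1r.
apply/cvg_lim => //.
under eq_fun do rewrite sumEFin.
apply/cvgeryP.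
have nd : nondecreasing_seq (series (@harmonic R)).
  by apply: nondecreasing_series => i _ _; exact: harmonic_ge0.
apply: contrapT => H; apply: (@dvg_harmonic R).
have [//|] := pselect (cvgn (series (@harmonic R))).
move=> /(nondecreasing_dvgn_lt nd) /cvgryPge h.
by exfalso; apply: H; apply/cvgryPge.
Qed.

(** To the right of 0, the bound [ln t < t] at t = 1 / sqrt z gives |z ln z| <= 2 sqrt z; to the
    left, [ln] is 0. *)
Lemma continuous_xlnx : continuous (fun x => x * ln x).
Proof.
move=> x; have [x0|x0|->] := ltgtP x 0.
- rewrite /continuous_at (@ln0 _ x) ?ltW// mulr0.
  apply: cvg_near_cst; near=> z; rewrite ln0 ?mulr0//.
  by apply: ltW; near: z; exact: lt_nbhsl.
- by apply: cvgM; [exact: cvg_id|exact: continuous_ln].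
rewrite /continuous_at mul0r.
apply: norm_cvg0.
apply: (@squeeze_cvgr _ _ _ _ (fun=> 0) (fun z => 2 * Num.sqrt z)).
- near=> z; rewrite normr_ge0/=.
  have [z0|z0] := leP z 0; first by rewrite ln0// mulr0 normr0 mulr_ge0 ?sqrtr_ge0.
  have z1 : z <= 1 by apply: ltW; near: z; exact: (@lt_nbhsl R 0 1).
  have s0 : 0 < Num.sqrt z by rewrite sqrtr_gt0.
  have := @ln_sublinear R (Num.sqrt z)^-1.
  rewrite invr_gt0 => /(_ s0); rewrite lnV// => h.
  rewrite ler0_norm ?mulr_ge0_le0 ?ln_le0 ?(ltW z0)//.
  rewrite -{1 2}(sqr_sqrtr (ltW z0)) lnXn// -mulr_natl.
  have := h; rewrite -(ltr_pM2l s0) divff ?gt_eqF// => h2.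
  rewrite expr2 -mulrA -mulrN mulrCA.
  by rewrite -(ler_pM2r (_ : 0 < 1)) //; nra.
- exact: cvg_cst.
- have H := @sqrt_continuous R 0; rewrite /continuous_at sqrtr0 in H.
  by rewrite -[X in _ --> X](mulr0 2); apply: cvgMr.
Unshelve. all: by end_near. Qed.


Lemma half_anglesE x :
  (1 + cos x) / 2 = cos (x / 2) ^+ 2 /\ (1 - cos x) / 2 = sin (x / 2) ^+ 2.
Proof.
have := cosD (x / 2) (x / 2); rewrite -splitr => ->.
have := @cos2Dsin2 R (x / 2); rewrite -!expr2 => h.
by split; nra.
Qed.

(* The right-hand sides are continuous up to 0 and pi, since [ln 0 = 0] makes
   [x * ln x] continuous at 0. *)
Lemma sin_ln_half_angle x : x \in `[0, pi] ->
  sin x * ln ((1 + cos x) / 2) = 4 * (sin (x / 2) * (cos (x / 2) * ln (cos (x / 2)))) /\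
  sin x * ln ((1 - cos x) / 2) = 4 * (cos (x / 2) * (sin (x / 2) * ln (sin (x / 2)))).
Proof.
rewrite in_itv/= => /andP[x0 xpi].
have c0 : 0 <= cos (x / 2) by apply: cos_ge0_pihalf; apply/andP; split; lra.
have s0 : 0 <= sin (x / 2) by apply: sin_ge0_pi; apply/andP; split; lra.
have lnX (z : R) : 0 <= z -> ln (z ^+ 2) = 2 * ln z.
  rewrite le_eqVlt => /predU1P[<-|z0]; first by rewrite expr0n/= ln0// mulr0.
  by rewrite lnXn// mulr_natl.
have sE : sin x = 2 * (sin (x / 2) * cos (x / 2)).
  by rewrite [in LHS](splitr x) sinD; ring.
have [-> ->] := half_anglesE x; rewrite sE !lnX//; split; ring.
Qed.

(** An antiderivative of [- sin x * ln y]: the derivative of y - y ln y in y is - ln y, and dy = -+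
    sin x / 2 dx, with the sign chosen by [b]. *)
Definition polar_primitive (b : bool) x : R :=
  let y := (1 + (-1) ^+ b * cos x) / 2 in - 2 * (-1) ^+ b * (y - y * ln y).

Lemma integral_sin_log_cos (b : bool) (k s t : R) : 0 <= s -> s <= t -> t <= pi ->
  (\int[lebesgue_measure]_(x in `[s, t])
     (sin x * (- ln ((1 + (-1) ^+ b * cos x) / 2) + k))%:E =
   (polar_primitive b t - polar_primitive b s + k * (cos s - cos t))%:E)%E.
Proof.
move=> s0; rewrite le_eqVlt => /predU1P[->|st] tpi.
  by rewrite set_itv1 integral_set1 !subrr mulr0 addr0.
pose h (z : R) := z * ln z.
(* The half-angle form of the integrand is continuous on the whole line, so the fundamental theorem
   of calculus applies up to 0 and pi, although the primitive is differentiated only in the open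
   interval. *)
pose f x : R := if b then - (4 * (cos (x / 2) * h (sin (x / 2))))
                else - (4 * (sin (x / 2) * h (cos (x / 2)))).
have half : continuous (fun x : R => x / 2).
  by move=> x; apply: cvgM; [exact: cvg_id|exact: cvg_cst].
have chalf : continuous (fun x : R => cos (x / 2)).
  by move=> x; apply: (@continuous_comp _ _ _ (fun x => x / 2) cos); [exact: half|exact: continuous_cos].
have shalf : continuous (fun x : R => sin (x / 2)).
  by move=> x; apply: (@continuous_comp _ _ _ (fun x => x / 2) sin); [exact: half|exact: continuous_sin].
have hc (g : R -> R) : continuous g -> continuous (fun x => h (g x)).
  by move=> cg x; apply: (@continuous_comp _ _ _ g h); [exact: cg|exact: continuous_xlnx].
have fc : continuous f.
  move=> x; rewrite /f; case: (b); apply: cvgN; apply: cvgMr; apply: cvgM;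
    by [exact: chalf|exact: shalf|exact: (hc _ shalf)|exact: (hc _ chalf)].
pose g x := f x + k * sin x.
have gc : continuous g.
  by move=> x; apply: cvgD; [exact: fc|apply: cvgMr; exact: continuous_sin].
pose G x := polar_primitive b x - k * cos x.
have fE x : x \in `[0, pi] -> f x = sin x * - ln ((1 + (-1) ^+ b * cos x) / 2).
  move=> x0pi; have [e1 e2] := sin_ln_half_angle x0pi.
  rewrite /f /h mulrN; case: (b).
    by rewrite expr1 mulN1r e2.
  by rewrite expr0 mul1r e1.
pose Y x : R := (1 + (-1) ^+ b * cos x) / 2.
have Yc : continuous Y.
  move=> x; apply: cvgM; last exact: cvg_cst.
  apply: cvgD; first exact: cvg_cst.
  by apply: cvgMr; exact: continuous_cos.
have Pc : continuous (polar_primitive b).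
  move=> x; rewrite /polar_primitive; apply: cvgMr; apply: cvgB; first exact: Yc.
  exact: (hc _ Yc).
have Pd x : x \in `]s, t[ -> is_derive x 1 (polar_primitive b) (f x).
  rewrite in_itv/= => /andP[sx xt].
  have x0pi : x \in `[0, pi] by rewrite in_itv/=; apply/andP; split; lra.
  have Y0 : 0 < Y x.
    rewrite /Y; case: (b).
      rewrite expr1 mulN1r (half_anglesE x).2 exprn_gt0//.
      by apply: sin_gt0_pi; apply/andP; split; lra.
    rewrite expr0 mul1r (half_anglesE x).1 exprn_gt0//.
    by apply: cos_gt0_pihalf; apply/andP; split; lra.
  have dY : is_derive x 1 Y ((-1) ^+ b * - sin x / 2).
    apply: (@is_derive_congr (2^-1 \*: (cst 1 + ((-1) ^+ b \*: cos)))).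
    - by move=> z; rewrite /Y/= !fctE /cst /GRing.scale/= mulrC.
    - by rewrite add0r /GRing.scale/= mulrC.
  have dln : is_derive (Y x) 1 (@ln R) (Y x)^-1 by exact: is_derive1_ln.
  have dlnY := @is_derive1_comp _ (@ln R) Y _ _ _ dln dY.
  have dP := is_deriveZ (- 2 * (-1) ^+ b) (is_deriveB dY (is_deriveM dY dlnY)).
  apply: (is_derive_congr dP); first by move=> z.
  rewrite fE// -/(Y x) /= /GRing.scale/=.
  rewrite [Y x * _]mulrA divff ?gt_eqF// mul1r.
  have e : (-1) ^+ b * (-1) ^+ b = 1 :> R by rewrite -signr_addb addbb.
  set L := ln _.
  transitivity ((-1) ^+ b * (-1) ^+ b * (sin x * - L)); last by rewrite e mul1r.
  by field.
have Gc : continuous G.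
  by move=> x; apply: cvgB; [exact: Pc|apply: cvgMr; exact: continuous_cos].
have Gd x : x \in `]s, t[ -> is_derive x 1 G (g x).
  move=> /Pd dP; have dG := is_deriveB dP (is_deriveZ k (is_derive_cos x)).
  apply: (is_derive_congr dG); first by move=> z.
  by rewrite /g /GRing.scale/= mulrN opprK.
transitivity (\int[lebesgue_measure]_(x in `[s, t]) (g x)%:E)%E.
  apply: eq_integral => x; rewrite inE/= in_itv/= => /andP[sx xt]; congr EFin.
  rewrite /g fE; first by ring.
  by rewrite in_itv/=; apply/andP; split; lra.
rewrite (@continuous_FTC2 _ g G)//.
- by rewrite -EFinB; congr EFin; rewrite /G; ring.
- exact: continuous_subspaceT.
- split.
  + by move=> x /Gd [].
  + by apply: cvg_at_right_filter; exact: Gc.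
  + by apply: cvg_at_left_filter; exact: Gc.
- by move=> x /Gd [_ ?]; rewrite derive1E.
Qed.

End LogFacts.

(** * The mean logarithmic distance to a circle *)

Section LogCircle.
Context {R : realType}.
Implicit Types f : R -> R.
Notation mu := (@lebesgue_measure R).

Lemma continuous_integrable_itv f a b : continuous f ->
  mu.-integrable `[a, b] (EFin \o f).
Proof.
move=> cf; apply: continuous_compact_integrable; first exact: segment_compact.
exact: continuous_subspaceT.
Qed.

Lemma continuous_Rintegral_split f a b c : continuous f -> a <= c -> c <= b ->
  \int[mu]_(x in `[a, b]) f x = \int[mu]_(x in `[a, c]) f x + \int[mu]_(x in `[c, b]) f x.
Proof.
move=> cf ac cb.
have := @Rintegral_itvB R f (BLeft a) (BRight b) c (continuous_integrable_itv a b cf).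
rewrite !bnd_simp => /(_ ac cb).
rewrite Rintegral_itv_obnd_cbnd; first by move=> <-; rewrite addrC subrK.
apply: integrableS (continuous_integrable_itv c b cf) => //.
exact: subset_itv_oc_cc.
Qed.

Lemma Rintegral_half_affine f a b c : continuous f -> a <= b ->
  \int[mu]_(x in `[a, b]) f (x / 2 + c) = 2 * \int[mu]_(x in `[a / 2 + c, b / 2 + c]) f x.
Proof.
move=> cf ab.
pose F (x : R) := x / 2 + c.
have dF (x : R) : is_derive x 1 F 2^-1.
  apply: (@is_derive_congr _ (2^-1 \*: id + cst c)).
  - by move=> z; rewrite /F !fctE /cst /GRing.scale/= mulrC.
  - by rewrite addr0 /GRing.scale/= mulr1.
have F'E : derive1 F = cst 2^-1.
  by apply/funext => x; rewrite derive1E; have [_ ->] := dF x.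
have cF : continuous F.
  by move=> x; apply: cvgD; [apply: cvgM; [exact: cvg_id|exact: cvg_cst]|exact: cvg_cst].
rewrite /Rintegral.
rewrite -[in RHS]/(F a) -[in RHS]/(F b).
rewrite (@integration_by_substitution_increasing R F f a b)//.
- rewrite F'E -[LHS]/(Rintegral mu `[a, b] (f \o F)).
  rewrite -[X in _ = 2 * X]/(Rintegral mu `[a, b] (fun x => f (F x) * 2^-1)).
  rewrite RintegralZr//.
    by rewrite mulrC divfK// pnatr_eq0.
  apply: continuous_integrable_itv => x.
  by apply: continuous_comp; [exact: cF|exact: cf].
- by move=> x y _ _ xy; rewrite /F; lra.
- by rewrite F'E => x _; exact: cvg_cst.
- by rewrite F'E; exact: is_cvg_cst.
- by rewrite F'E; exact: is_cvg_cst.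
- split.
  + by move=> x _; have [] := dF x.
  + by apply: cvg_at_right_filter; exact: cF.
  + by apply: cvg_at_left_filter; exact: cF.
- exact: continuous_subspaceT.
Qed.

(* The squared distance from e^(ix) to p + iq. *)
Definition circle_dist2 (p q x : R) := 1 + (p ^+ 2 + q ^+ 2) - 2 * (p * cos x + q * sin x).

Lemma circle_dist2E p q x : circle_dist2 p q x = (cos x - p) ^+ 2 + (sin x - q) ^+ 2.
Proof. by rewrite /circle_dist2 -{1}(cos2Dsin2 x); ring. Qed.

Lemma circle_dist2_ge0 p q x : 0 <= circle_dist2 p q x.
Proof. by rewrite circle_dist2E addr_ge0 ?sqr_ge0. Qed.

Lemma continuous_circle_dist2 p q : continuous (circle_dist2 p q).
Proof.
move=> x; apply: cvgB; first exact: cvg_cst.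
apply: cvgMr; apply: cvgD; apply: cvgMr; [exact: continuous_cos|exact: continuous_sin].
Qed.

(** The squared distance lies between (1 - |w|)^2 and (1 + |w|)^2 by Cauchy-Schwarz, here obtained
    from Lagrange's identity. *)
Lemma circle_dist2_bounds p q (r x : R) : 0 <= r -> r <= 1 -> p ^+ 2 + q ^+ 2 <= r ^+ 2 ->
  (1 - r) ^+ 2 <= circle_dist2 p q x <= 4.
Proof.
move=> r0 r1 pqr; set m := p ^+ 2 + q ^+ 2 in pqr *.
have m0 : 0 <= m by rewrite addr_ge0 ?sqr_ge0.
pose s := Num.sqrt m; have s0 : 0 <= s := sqrtr_ge0 m.
have sE : s ^+ 2 = m by rewrite sqr_sqrtr.
have sr : s <= r by rewrite -(ler_pXn2r (_ : 0 < 2)%N) ?nnegrE// sE.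
have : (p * cos x + q * sin x) ^+ 2 <= s ^+ 2.
  rewrite sE -[leRHS]mulr1 -(cos2Dsin2 x) /m.
  have -> : (p ^+ 2 + q ^+ 2) * (cos x ^+ 2 + sin x ^+ 2) =
    (p * cos x + q * sin x) ^+ 2 + (p * sin x - q * cos x) ^+ 2 by ring.
  by rewrite lerDl sqr_ge0.
rewrite -ler_sqrt ?sqr_ge0// !sqrtr_sqr (ger0_norm s0) ler_norml => /andP[h1 h2].
rewrite /circle_dist2 -/m -sE; apply/andP; split; nra.
Qed.

Lemma circle_dist2_doubling p q x :
  circle_dist2 p q (x / 2) * circle_dist2 p q (x / 2 + pi) =
  circle_dist2 (p ^+ 2 - q ^+ 2) (2 * (p * q)) x.
Proof.
rewrite /circle_dist2 cosDpi sinDpi.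
have h := cos2Dsin2 (x / 2).
have -> : cos x = cos (x / 2) ^+ 2 - sin (x / 2) ^+ 2.
  by rewrite [in LHS](splitr x) cosD; ring.
have -> : sin x = 2 * (sin (x / 2) * cos (x / 2)).
  by rewrite [in LHS](splitr x) sinD; ring.
set c := cos _ in h *; set s := sin _ in h *.
have -> : (p * c + q * s) = (p * c + q * s) * 1 by rewrite mulr1.
apply/eqP; rewrite -subr_eq0; apply/eqP.
transitivity ((2 * (p ^+ 2 + q ^+ 2)) * (1 - (c ^+ 2 + s ^+ 2)) ); last by rewrite h subrr mulr0.
by ring.
Qed.

Definition log_circle (p q : R) := \int[mu]_(x in `[0, 2 * pi]) ln (circle_dist2 p q x).

Lemma circle_dist2_gt0 p q x : p ^+ 2 + q ^+ 2 < 1 -> 0 < circle_dist2 p q x.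
Proof.
move=> pq1; have m0 : 0 <= p ^+ 2 + q ^+ 2 by rewrite addr_ge0 ?sqr_ge0.
have r1 : Num.sqrt (p ^+ 2 + q ^+ 2) < 1 by rewrite -sqrtr1 ltr_sqrt.
have := @circle_dist2_bounds p q _ x (sqrtr_ge0 _) (ltW r1).
rewrite sqr_sqrtr// => /(_ (lexx _)) /andP[+ _]; apply: lt_le_trans.
by rewrite exprn_gt0// subr_gt0.
Qed.

Lemma continuous_ln_circle_dist2 p q : p ^+ 2 + q ^+ 2 < 1 ->
  continuous (fun x => ln (circle_dist2 p q x)).
Proof.
move=> pq1 x; apply: (@continuous_comp _ _ _ (circle_dist2 p q) (@ln R)).
  exact: continuous_circle_dist2.
exact/continuous_ln/circle_dist2_gt0.
Qed.

(** The two halves of the circle are parametrised by x/2 and x/2 + pi with x in [0, 2 pi]; the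
    Jacobian 1/2 is the factor 2 on the left. On the right stands w^2 for w = p + iq. *)
Lemma log_circle_doubling p q : p ^+ 2 + q ^+ 2 < 1 ->
  2 * log_circle p q = log_circle (p ^+ 2 - q ^+ 2) (2 * (p * q)).
Proof.
move=> pq1; have cf := continuous_ln_circle_dist2 pq1.
have pi0 : 0 <= pi :> R := pi_ge0 R.
pose f x := ln (circle_dist2 p q x).
have chalf c : continuous (fun x : R => x / 2 + c).
  by move=> x; apply: cvgD; [apply: cvgM; [exact: cvg_id|exact: cvg_cst]|exact: cvg_cst].
rewrite /log_circle (@continuous_Rintegral_split _ _ _ pi)//; [|lra..].
have h1 := @Rintegral_half_affine f 0 (2 * pi) 0 cf.
have h2 := @Rintegral_half_affine f 0 (2 * pi) pi cf.
rewrite mul0r !add0r !addr0 in h1 h2.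
have e1 : 2 * pi / 2 = pi :> R by field.
have e2 : pi + pi = 2 * pi :> R by ring.
rewrite e1 in h1; rewrite e1 e2 in h2.
rewrite mulrDr -h1 ?mulr_ge0// -h2 ?mulr_ge0//.
rewrite -RintegralD//; first last.
- apply: (@continuous_integrable_itv (f \o (fun x : R => x / 2 + pi))) => x.
  by apply: continuous_comp; [exact: chalf|exact: cf].
- apply: (@continuous_integrable_itv (f \o (fun x : R => x / 2 + 0))) => x.
  by apply: continuous_comp; [exact: chalf|exact: cf].
apply: eq_Rintegral => x _; rewrite /f addr0 -lnM ?posrE ?circle_dist2_gt0//.
by rewrite circle_dist2_doubling.
Qed.

Lemma log_circle_bound (r : R) : 0 <= r -> r < 1 -> exists C : R, forall p q,
  p ^+ 2 + q ^+ 2 <= r ^+ 2 -> `|log_circle p q| <= C.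
Proof.
move=> r0 r1; pose c := Num.max (ln 4) (- ln ((1 - r) ^+ 2)).
exists (c * fine (mu `[0, 2 * pi])) => p q pqr.
have r21 : r ^+ 2 < 1 by rewrite expr_lt1.
have cf := continuous_ln_circle_dist2 (le_lt_trans pqr r21).
have r1' : 0 < (1 - r) ^+ 2 by rewrite exprn_gt0// subr_gt0.
rewrite -Rintegral_cst//; apply: le_trans (le_normr_Rintegral _ _) _ => //.
  exact: continuous_integrable_itv.
apply: le_Rintegral => //.
- apply: (@continuous_integrable_itv (fun x => `|ln (circle_dist2 p q x)|)) => x.
  exact: (cvg_norm (cf x)).
- by apply: (@continuous_integrable_itv (cst c)) => x; exact: cvg_cst.
move=> x _; have /andP[b1 b2] := @circle_dist2_bounds p q r x r0 (ltW r1) pqr.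
have Q0 : 0 < circle_dist2 p q x := lt_le_trans r1' b1.
rewrite ler_norml; apply/andP; split.
  rewrite lerNl /c le_max; apply/orP; right.
  by rewrite lerN2 ler_ln ?posrE.
by rewrite /c le_max; apply/orP; left; rewrite ler_ln ?posrE.
Qed.

(** Repeated squaring keeps w inside the disc of its initial radius, where [log_circle] is bounded
    by some C, while the value doubles each time. A nonzero value J would violate 2^n |J| <= C as
    soon as n > C / |J|. *)
Lemma log_circle0 p q : p ^+ 2 + q ^+ 2 < 1 -> log_circle p q = 0.
Proof.
move=> pq1; have m0 : 0 <= p ^+ 2 + q ^+ 2 by rewrite addr_ge0 ?sqr_ge0.
have r1 : Num.sqrt (p ^+ 2 + q ^+ 2) < 1 by rewrite -sqrtr1 ltr_sqrt.
have [C hC] := log_circle_bound (sqrtr_ge0 _) r1.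
rewrite sqr_sqrtr// in hC.
have H n : exists p' q', p' ^+ 2 + q' ^+ 2 <= p ^+ 2 + q ^+ 2 /\
    2 ^+ n * log_circle p q = log_circle p' q'.
  elim: n => [|n [p' [q' [le_pq IH]]]]; first by exists p, q; rewrite expr0 mul1r.
  exists (p' ^+ 2 - q' ^+ 2), (2 * (p' * q')); split.
    have -> : (p' ^+ 2 - q' ^+ 2) ^+ 2 + (2 * (p' * q')) ^+ 2 =
      (p' ^+ 2 + q' ^+ 2) * (p' ^+ 2 + q' ^+ 2) by ring.
    have le1 := le_trans le_pq (ltW pq1).
    by apply: le_trans le_pq; rewrite ler_piMl ?addr_ge0 ?sqr_ge0//.
  by rewrite exprS -mulrA IH log_circle_doubling// (le_lt_trans le_pq).
have C0 : 0 <= C by apply: le_trans (hC p q (lexx _)).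
apply/eqP; rewrite -normr_eq0 eq_le normr_ge0 andbT.
rewrite leNgt; apply/negP => J0.
set J := `|_| in J0.
pose n := (Num.truncn (C / J)).+1.
have [p' [q' [le_pq e]]] := H n.
have := hC p' q' le_pq; rewrite -e normrM normrX ger0_norm// -/J => le1.
have : C / J < n%:R by exact: truncnS_gt.
rewrite ltr_pdivrMr// => lt2.
have : (n%:R : R) <= 2 ^+ n by rewrite -natrX ler_nat ltnW// ltn_expl.
move=> le3; have := lt_le_trans lt2 (le_trans (ler_wpM2r (ltW J0) le3) le1).
by rewrite ltxx.
Qed.

End LogCircle.

(** * The mean over the circle for |w| <= 1, with values in the extended reals *)

Section LogCircleClosed.
Context {R : realType}.
Notation mu := (@lebesgue_measure R).

Lemma lebesgue_measure_circle : mu `[0, 2 * pi] = (2 * pi)%:E.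
Proof.
by rewrite lebesgue_measure_itv/= lte_fin mulr_gt0 ?pi_gt0// oppr0 adde0.
Qed.

Lemma integral_ln_circle_dist2 (p q A : R) : p ^+ 2 + q ^+ 2 < 1 -> 0 < A ->
  (\int[mu]_(x in `[0%R, (2 * pi)%R]) (- ln (A * circle_dist2 p q x))%:E =
   (- (2 * pi * ln A))%:E)%E.
Proof.
move=> pq1 A0; have cf := continuous_ln_circle_dist2 pq1.
have iF := continuous_integrable_itv 0 (2 * pi) cf.
have iA : mu.-integrable `[0, 2 * pi] (EFin \o cst (- ln A)).
  by apply: continuous_integrable_itv => x; exact: cvg_cst.
transitivity ((\int[mu]_(x in `[0, 2 * pi]) (- ln A - ln (circle_dist2 p q x)))%:E).
  rewrite /Rintegral fineK; last first.
    apply: integrable_fin_num => //.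
    apply: (@continuous_integrable_itv R (fun x => - ln A - ln (circle_dist2 p q x))) => x.
    by apply: cvgB; [exact: cvg_cst|exact: cf].
  apply: eq_integral => x _; congr EFin.
  by rewrite lnM ?posrE ?circle_dist2_gt0// opprD.
rewrite RintegralB//.
rewrite -/(log_circle p q) log_circle0// subr0 Rintegral_cst//.
rewrite [fine _](_ : _ = 2 * pi); first by rewrite mulrC mulrN.
exact: (congr1 fine lebesgue_measure_circle).
Qed.

Lemma measurable_lne : measurable_fun setT (fun x : R => lne x%:E).
Proof.
rewrite (_ : (fun x : R => lne x%:E) = fun x => if x <= 0 then -oo%E else (ln x)%:E); last first.
  apply/funext => x; case: ifPn => [x0|]; first by rewrite le0_lneNy.
  by rewrite -ltNge => x0; rewrite lne_EFin.
apply: measurable_fun_ifT.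
- by apply: measurable_fun_ler.
- exact: measurable_cst.
- by apply/measurable_EFinP; exact: measurable_ln.
Qed.

Lemma measurable_lne_circle_dist2 (p q A : R) (D : set R) :
  measurable_fun D (fun x => (- lne (A * circle_dist2 p q x)%:E)%E).
Proof.
apply: measurable_funTS; apply: measurableT_comp => //.
apply: (measurableT_comp measurable_lne).
apply: measurable_funM; first exact: measurable_cst.
by apply: continuous_measurable_fun; exact: continuous_circle_dist2.
Qed.

(* On the unit circle, [circle_dist2 (rho * p) (rho * q) / rho] decreases to
   [circle_dist2 p q] as rho increases to 1, which allows monotone convergence. *)
Lemma integral_lne_circle_dist2 (p q B : R) : p ^+ 2 + q ^+ 2 <= 1 -> 0 < B ->
  (forall x, B * circle_dist2 p q x <= 1) ->
  (\int[mu]_(x in `[0%R, (2 * pi)%R]) (- lne (B * circle_dist2 p q x)%:E) =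
   (- (2 * pi * ln B))%:E)%E.
Proof.
rewrite le_eqVlt => /predU1P[pq1|pq1] B0 B1; last first.
  rewrite -(integral_ln_circle_dist2 pq1 B0); apply: eq_integral => x _.
  by rewrite lne_EFin// mulr_gt0// circle_dist2_gt0.
pose Q := circle_dist2 p q.
(* This is (1 - rho)^2 / rho for rho = (n + 1) / (n + 2), the amount by which the rescaled distance
   exceeds its limit when |w| = 1; it does not depend on x. *)
pose eps (n : nat) : R := n.+1%:R^-1 * n.+2%:R^-1.
pose rho (n : nat) : R := n.+1%:R / n.+2%:R.
have eps0 n : 0 < eps n by rewrite mulr_gt0// invr_gt0.
have rho0 n : 0 < rho n by rewrite divr_gt0.
have rho1 n : rho n < 1 by rewrite ltr_pdivrMr// mul1r ltr_nat.
have QE n x : Q x + eps n = (rho n)^-1 * circle_dist2 (rho n * p) (rho n * q) x.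
  rewrite /Q /circle_dist2 !exprMn -mulrDr pq1 /rho /eps -[n.+2%:R]natr1.
  have : (n.+1%:R : R) != 0 by rewrite pnatr_eq0.
  have : (n.+1%:R + 1 : R) != 0 by rewrite natr1 pnatr_eq0.
  by move: (n.+1%:R) => a h1 h2; field; rewrite h1 h2.
have eps_nd m n : (m <= n)%N -> eps n <= eps m.
  by move=> mn; rewrite /eps ler_pM// lef_pV2 ?posrE ?ltr0n// ler_nat.
have eps_cvg : eps @ \oo --> 0.
  apply: (@squeeze_cvgr _ _ _ _ (fun=> 0) (@harmonic R)); last 2 first.
  - exact: cvg_cst.
  - exact: cvg_harmonic.
  near=> n; rewrite (ltW (eps0 n))/= /eps ler_piMr ?invr_ge0//.
  by rewrite invf_le1// ler1n.
(* Monotone convergence needs nonnegative functions. Since B Q <= 1 and eps <= 1, dividing by 1 + B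
   keeps the arguments of the logarithms at most 1; the constant [ln D] is taken out again at the
   end. *)
pose D : R := 1 + B.
have D0 : 0 < D by rewrite addr_gt0.
have D1 : 1 <= D by rewrite lerDl ltW.
have Q0 x : 0 <= Q x := circle_dist2_ge0 p q x.
pose A := B / D; have A0 : 0 < A by rewrite divr_gt0.
pose f n x : R := - ln (A * (Q x + eps n)).
have Qe0 n x : 0 < Q x + eps n by rewrite ltr_wpDl.
have f0 n x : 0 <= f n x.
  rewrite oppr_ge0 ln_le0// /A mulrAC ler_pdivrMr// mul1r mulrDr.
  rewrite /D; apply: lerD; first exact: B1.
  by rewrite ler_piMr ?(ltW B0)// /eps mulr_ile1 ?invr_ge0// invf_le1// ler1n.
have f_nd x : {homo f^~ x : m n / (m <= n)%N >-> m <= n}.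
  move=> m n mn; rewrite /f lerN2 ler_ln ?posrE ?(mulr_gt0 A0 (Qe0 _ _))//.
  by rewrite ler_pM2l// lerD2l eps_nd.
have f_cvg x : (f n x)%:E @[n --> \oo] --> (- lne (A * Q x)%:E)%E.
  have AQ : (A * (Q x + eps n)) @[n --> \oo] --> A * Q x.
    apply: cvgMr; rewrite -[X in _ --> X]addr0.
    by apply: cvgD; [exact: cvg_cst|exact: eps_cvg].
  have := Q0 x; rewrite le_eqVlt => /predU1P[Qx0|Qx0]; last first.
    rewrite lne_EFin ?(mulr_gt0 A0 Qx0)// -EFinN; apply: cvg_EFin; first exact: nearW.
    apply: cvgN; apply: (continuous_cvg _ _ AQ).
    exact: (continuous_ln (mulr_gt0 A0 Qx0)).
  rewrite -Qx0 mulr0 le0_lneNy//=.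
  rewrite -Qx0 mulr0 in AQ.
  apply/cvgeryP/cvgryPge => M; near=> n.
  rewrite /f -Qx0 lerNr -(expRK (- M)) ler_ln ?posrE ?expR_gt0//; last first.
    by have := mulr_gt0 A0 (Qe0 n x); rewrite -Qx0.
  by apply: ltW; near: n; apply: (cvgr_lt _ AQ); exact: expR_gt0.
have cQ := @continuous_circle_dist2 R p q.
have cf n : continuous (f n).
  move=> x; apply: cvgN.
  have AQ : (A * (Q z + eps n)) @[z --> x] --> A * (Q x + eps n).
    by apply: cvgMr; apply: cvgD; [exact: cQ|exact: cvg_cst].
  exact: (continuous_cvg _ (continuous_ln (mulr_gt0 A0 (Qe0 n x))) AQ).
have mf n : measurable_fun setT (f n) by exact: continuous_measurable_fun.
have mI : measurable (`[0%R, (2 * pi)%R] : set R) by [].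
have intA : (\int[mu]_(x in `[0%R, (2 * pi)%R]) (- lne (A * Q x)%:E) =
   (- (2 * pi * ln A))%:E)%E.
  under eq_integral do rewrite -(cvg_lim _ (f_cvg _))//.
  rewrite monotone_convergence//; last 3 first.
  - by move=> n; apply/measurable_EFinP; apply: measurable_funTS; exact: mf.
  - by move=> n x _; rewrite lee_fin.
  - by move=> x _ m n mn; rewrite lee_fin f_nd.
  apply/cvg_lim => //.
  have iE n : (\int[mu]_(x in `[0%R, (2 * pi)%R]) (f n x)%:E)%E =
      (- (2 * pi * ln (A / rho n)))%:E.
    rewrite -(@integral_ln_circle_dist2 (rho n * p) (rho n * q)) ?divr_gt0//.
      by apply: eq_integral => x _; rewrite /f QE mulrA.
    have -> : (rho n * p) ^+ 2 + (rho n * q) ^+ 2 = rho n ^+ 2 * (p ^+ 2 + q ^+ 2) by ring.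
    by rewrite pq1 mulr1 expr_lt1//; exact: ltW.
  under eq_fun do rewrite iE.
  apply: cvg_EFin; first exact: nearW.
  apply: cvgN; apply: cvgMr.
  have rho_cvg : rho @ \oo --> (1 : R).
    have -> : rho = (fun n => 1 - harmonic n.+1).
      apply/funext => n; rewrite /rho /= -[n.+2%:R in LHS]natr1 -[n.+2%:R in RHS]natr1.
      have : (n.+1%:R + 1 : R) != 0 by rewrite natr1 pnatr_eq0.
      by move: (n.+1%:R) => a h; field.
    rewrite -[X in _ --> X]subr0; apply: cvgB; first exact: cvg_cst.
    have := @cvg_harmonic R; rewrite -cvg_shiftS; exact.
  have A_cvg : A / rho n @[n --> \oo] --> A.
    have e : A / 1 = A by rewrite divr1.
    rewrite -{2}e; apply: cvgMr.
    by apply: cvgV; [exact: oner_neq0|exact: rho_cvg].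
  exact: (continuous_cvg _ (continuous_ln A0) A_cvg).
(* The identity also holds where Q vanishes, both sides being +oo. After integration only a finite
   constant has to be cancelled. *)
have BE x : (- lne (A * Q x)%:E = - lne (B * Q x)%:E + (ln D)%:E)%E.
  have := Q0 x; rewrite le_eqVlt => /predU1P[<-|Qx0].
    by rewrite !mulr0 le0_lneNy.
  rewrite !lne_EFin ?(mulr_gt0 A0 Qx0) ?(mulr_gt0 B0 Qx0)// -!EFinN -EFinD /A mulrAC.
  rewrite ln_div ?posrE ?(mulr_gt0 B0 Qx0)//.
  by rewrite opprB addrC.
have : (\int[mu]_(x in `[0%R, (2 * pi)%R]) (- lne (A * Q x)%:E) =
    \int[mu]_(x in `[0%R, (2 * pi)%R]) (- lne (B * Q x)%:E) + (2 * pi * ln D)%:E)%E.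
  under eq_integral do rewrite BE.
  rewrite ge0_integralD//; last 3 first.
  - by move=> x _; rewrite oppe_ge0 lne_le0 lee_fin B1.
  - exact: measurable_lne_circle_dist2.
  - by move=> x _; rewrite lee_fin ln_ge0.
  rewrite (@integral_cst _ _ _ mu _ mI (ln D)%:E).
  congr (_ + _)%E; transitivity ((ln D)%:E * (2 * pi)%:E)%E; last by rewrite -EFinM mulrC.
  by congr (_ * _)%E; exact: lebesgue_measure_circle.
rewrite intA => e.
have -> : - (2 * pi * ln B) = - (2 * pi * ln A) - 2 * pi * ln D.
  by rewrite /A ln_div ?posrE//; ring.
by rewrite EFinB e addeK.
Unshelve. all: by end_near. Qed.

End LogCircleClosed.

(** * Positive definiteness of the Coulomb kernel *)

Section LinearCombination.
Context d {T : measurableType d} {R : realType}.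
Variables (mu : {measure set T -> \bar R}) (D : set T).
Hypothesis mD : measurable D.

Lemma integral_lin_comb (I : finType) (c : I -> R) (G : I -> T -> R) :
  (forall i, mu.-integrable D (EFin \o G i)) ->
  (\int[mu]_(x in D) (\sum_i c i * G i x)%:E =
   (\sum_i c i * \int[mu]_(x in D) G i x)%:E)%E.
Proof.
move=> iG.
under eq_integral do rewrite -sumEFin.
rewrite integral_sum//; last first.
  by move=> i; exact: (integrableZl mD (c i) (iG i)).
rewrite -sumEFin; apply: eq_bigr => i _.
under eq_integral do rewrite EFinM.
rewrite (integralZl mD (iG i)) EFinM /Rintegral fineK//.
exact: (integrable_fin_num mD (iG i)).
Qed.

End LinearCombination.

Section SphereKernel.
Context {R : realType}.
Implicit Types r s : space3 R.

Lemma sphereE r : sphere r <-> r.1.1 ^+ 2 + r.1.2 ^+ 2 + r.2 ^+ 2 = 4^-1.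
Proof.
rewrite /sphere/= /euclid_dist/= !subr0; set S := _ + _ + _.
have S0 : 0 <= S by rewrite !addr_ge0 ?sqr_ge0.
split => [h|->].
  by rewrite -(sqr_sqrtr S0) h; field.
by rewrite (_ : 4^-1 = 2^-1 ^+ 2) ?sqrtr_sqr ?ger0_norm ?invr_ge0//; field.
Qed.

(* This is 1 - |r - s|^2 when r and s are on the sphere. *)
Definition sphere_kernel r s : R :=
  2^-1 + 2 * (r.1.1 * s.1.1 + r.1.2 * s.1.2 + r.2 * s.2).

Lemma sphere_kernel_ge0 r s : sphere r -> sphere s -> 0 <= sphere_kernel r s.
Proof.
move=> /sphereE hr /sphereE hs; rewrite /sphere_kernel.
have : 0 <= (r.1.1 + s.1.1) ^+ 2 + (r.1.2 + s.1.2) ^+ 2 + (r.2 + s.2) ^+ 2.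
  by rewrite !addr_ge0 ?sqr_ge0.
nra.
Qed.

Lemma dist2_sphere r s : sphere r -> sphere s ->
  (r.1.1 - s.1.1) ^+ 2 + (r.1.2 - s.1.2) ^+ 2 + (r.2 - s.2) ^+ 2 = 1 - sphere_kernel r s.
Proof. by move=> /sphereE hr /sphereE hs; rewrite /sphere_kernel; nra. Qed.

Lemma sphere_kernel_le1 r s : sphere r -> sphere s -> sphere_kernel r s <= 1.
Proof.
move=> hr hs; rewrite -subr_ge0 -dist2_sphere//.
by rewrite !addr_ge0 ?sqr_ge0.
Qed.

(** For x <= 0 both sides are +oo, which covers coincident points. *)
Lemma lne_sqrt (x : R) : (- lne (Num.sqrt x)%:E = (2^-1)%:E * - lne x%:E)%E.
Proof.
have [x0|x0] := leP x 0.
  by rewrite ler0_sqrtr// !le0_lneNy ?lee_fin//= mulry gtr0_sg// mul1e.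
rewrite !lne_EFin ?sqrtr_gt0// -!EFinN -EFinM; congr EFin.
rewrite -{2}(sqr_sqrtr (ltW x0)) lnXn ?sqrtr_gt0// -mulr_natl.
by field.
Qed.

Lemma coulombE r s : sphere r -> sphere s ->
  (coulomb r s = (2^-1)%:E * - lne (1 - sphere_kernel r s)%:E)%E.
Proof. by move=> hr hs; rewrite /coulomb /euclid_dist dist2_sphere// lne_sqrt. Qed.

Lemma coulomb_series r s : sphere r -> sphere s ->
  (coulomb r s = \sum_(0 <= k <oo) (2^-1 * (sphere_kernel r s ^+ k.+1 / k.+1%:R))%:E)%E.
Proof.
move=> hr hs; rewrite coulombE// -lne_series ?sphere_kernel_ge0 ?sphere_kernel_le1//.
rewrite -nneseriesZl; first by apply: eq_eseriesr => k _; rewrite -EFinM.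
by move=> k _; rewrite lee_fin divr_ge0// exprn_ge0// sphere_kernel_ge0.
Qed.

Lemma coulomb_ge0 r s : sphere r -> sphere s -> (0 <= coulomb r s)%E.
Proof.
move=> hr hs; rewrite coulombE// mule_ge0 ?lee_fin// oppe_ge0 lne_le0 lee_fin.
by rewrite gerBl sphere_kernel_ge0.
Qed.

(** A feature map for [sphere_kernel]: in the coordinates (1, x, y, z) the kernel is diagonal with
    positive weights, so all its powers are positive combinations of products of a function of r and
    the same function of s. *)
Definition coord (i : 'I_4) r : R := [:: 1; r.1.1; r.1.2; r.2]`_i.
Definition coord_weight (i : 'I_4) : R := [:: 2^-1; 2; 2; 2]`_i.

Lemma sphere_kernel_coord r s :
  sphere_kernel r s = \sum_i coord_weight i * (coord i r * coord i s).
Proof. by rewrite !big_ord_recl big_ord0 /sphere_kernel /coord /coord_weight/=; ring. Qed.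

Lemma coord_weight_ge0 i : 0 <= coord_weight i.
Proof. by case: i => -[|[|[|[|]]]]//= ?; rewrite /coord_weight/=. Qed.

Lemma measurable_coord i : measurable_fun setT (coord i).
Proof.
case: i => -[|[|[|[|]]]]//= ?; rewrite /coord/=.
- exact: measurable_cst.
- by apply: measurableT_comp => //; exact: measurableT_comp.
- by apply: measurableT_comp => //; exact: measurableT_comp.
- exact: measurable_snd.
Qed.

Lemma coord_le1 i r : sphere r -> `|coord i r| <= 1.
Proof.
move=> /sphereE hr; have sq (x : R) : x ^+ 2 <= 1 -> `|x| <= 1.
  by move=> x1; rewrite -sqrtr_sqr -[leRHS]sqrtr1 ler_sqrt.
have h1 := sqr_ge0 r.1.1; have h2 := sqr_ge0 r.1.2; have h3 := sqr_ge0 r.2.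
case: i => -[|[|[|[|]]]]//= ?; rewrite /coord/= ?normr1//; apply: sq; lra.
Qed.

(** Indexed by words of length k instead of exponents, so that expanding a power produces no
    multinomial coefficients. *)
Definition monomial k (h : {ffun 'I_k -> 'I_4}) r := \prod_j coord (h j) r.
Definition monomial_weight k (h : {ffun 'I_k -> 'I_4}) := \prod_j coord_weight (h j).

Lemma monomial_weight_ge0 k (h : {ffun 'I_k -> 'I_4}) : 0 <= monomial_weight h.
Proof. by apply: prodr_ge0 => j _; exact: coord_weight_ge0. Qed.

Lemma sphere_kernelX k r s : sphere_kernel r s ^+ k =
  \sum_(h : {ffun 'I_k -> 'I_4}) monomial_weight h * (monomial h r * monomial h s).
Proof.
rewrite sphere_kernel_coord -[k in LHS]card_ord -prodr_const bigA_distr_bigA/=.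
by apply: eq_bigr => h _; rewrite !big_split.
Qed.

Lemma measurable_monomial k (h : {ffun 'I_k -> 'I_4}) : measurable_fun setT (monomial h).
Proof. by apply: measurable_prod => j _; exact: measurable_coord. Qed.

Lemma monomial_le1 k (h : {ffun 'I_k -> 'I_4}) r : sphere r -> `|monomial h r| <= 1.
Proof.
move=> hr; rewrite normr_prod; rewrite prodr_ile1// => j _.
by rewrite normr_ge0 coord_le1.
Qed.

Lemma measurable_sphere : measurable (@sphere R).
Proof.
(* The constant coordinate contributes 1 to the squared radius 1/4, hence 5/4. *)
rewrite (_ : sphere = (fun r : space3 R => \sum_(i < 4) coord i r ^+ 2) @^-1` [set 5 / 4]); last first.
  apply/seteqP; split => r.
    move=> /sphereE h /=; rewrite !big_ord_recl big_ord0 /coord/=; lra.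
  move=> /=; rewrite !big_ord_recl big_ord0 /coord/= => h.
  by apply/sphereE; lra.
rewrite -[X in measurable X]setTI.
have : measurable_fun setT (fun r : space3 R => \sum_(i < 4) coord i r ^+ 2).
  by apply: measurable_sum => i; apply: measurable_funX; exact: measurable_coord.
by apply => //; exact: measurable_set1.
Qed.

Lemma measurable_coulomb r : sphere r -> measurable_fun sphere (coulomb r).
Proof.
move=> hr.
apply: (@eq_measurable_fun _ _ _ _ _ (fun s =>
  \sum_(0 <= k <oo) (2^-1 * (sphere_kernel r s ^+ k.+1 / k.+1%:R))%:E)%E).
  by move=> s; rewrite inE => hs; rewrite coulomb_series.
apply: ge0_emeasurable_sum => [k s hs _|k _].
  rewrite lee_fin mulr_ge0 ?divr_ge0 ?exprn_ge0 ?sphere_kernel_ge0//.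
apply/measurable_EFinP; apply: measurable_funTS.
apply: measurable_funM; first exact: measurable_cst.
apply: measurable_funM; last exact: measurable_cst.
under eq_fun do rewrite sphere_kernelX.
apply: measurable_sum => h; apply: measurable_funM; first exact: measurable_cst.
by apply: measurable_funM; [exact: measurable_cst|exact: measurable_monomial].
Qed.

(** * Expansion of potentials and interactions in moments *)

Section Measures.
Implicit Types mu nu : {measure set space3 R -> \bar R}.

Lemma integrable_monomial mu k (h : {ffun 'I_k -> 'I_4}) : (mu sphere < +oo)%E ->
  mu.-integrable sphere (EFin \o monomial h).
Proof.
move=> mufin; apply: measurable_bounded_integrable => //.
- exact: measurable_sphere.
- by apply: measurable_funTS; exact: measurable_monomial.
- exists 1; split=> // M M1 r hr /=.
  exact: le_trans (monomial_le1 h hr) (ltW M1).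
Qed.

Definition moment mu k (h : {ffun 'I_k -> 'I_4}) : R :=
  \int[mu]_(r in sphere) monomial h r.

(** The contribution of the kernel power k + 1; the factor combines the series coefficient 1 / (k +
    1) with the 1/2 from the square root in the distance. *)
Definition power_energy mu nu k : R :=
  (2 * k.+1%:R)^-1 *
  \sum_(h : {ffun 'I_k.+1 -> 'I_4}) monomial_weight h * (moment mu h * moment nu h).

Lemma potential_series nu r : (nu sphere < +oo)%E -> sphere r ->
  (\int[nu]_(s in sphere) coulomb r s = \sum_(0 <= k <oo)
    (\sum_(h : {ffun 'I_k.+1 -> 'I_4})
      ((2 * k.+1%:R)^-1 * (monomial_weight h * moment nu h)) * monomial h r)%:E)%E.
Proof.
move=> nufin hr.
pose t k s : \bar R := (2^-1 * (sphere_kernel r s ^+ k.+1 / k.+1%:R))%:E.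
have tE k s : t k s = (\sum_(h : {ffun 'I_k.+1 -> 'I_4})
    ((2 * k.+1%:R)^-1 * (monomial_weight h * monomial h r)) * monomial h s)%:E.
  rewrite /t sphere_kernelX mulrA mulrAC -invfM mulr_sumr; congr EFin.
  by apply: eq_bigr => h _; rewrite !mulrA.
transitivity (\int[nu]_(s in sphere) (\sum_(0 <= k <oo) t k s))%E.
  by apply: eq_integral => s; rewrite inE => hs; rewrite coulomb_series.
rewrite integral_nneseries; last 3 first.
- exact: measurable_sphere.
- move=> k; rewrite (funext (tE k)).
  apply/measurable_EFinP; apply: measurable_funTS; apply: measurable_sum => h.
  by apply: measurable_funM; [exact: measurable_cst|exact: measurable_monomial].
- by move=> k s hs; rewrite lee_fin mulr_ge0 ?divr_ge0 ?exprn_ge0 ?sphere_kernel_ge0.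
apply: eq_eseriesr => k _.
under eq_integral do rewrite tE.
rewrite integral_lin_comb; last 2 first.
- exact: measurable_sphere.
- by move=> h; exact: integrable_monomial.
by congr EFin; apply: eq_bigr => h _; rewrite -/(moment nu h); ring.
Qed.

(** Individual monomials may contribute negatively; the whole sum is nonnegative because it is the
    integral of a power of the nonnegative kernel. *)
Lemma power_potential_ge0 nu r k : (nu sphere < +oo)%E -> sphere r ->
  0 <= \sum_(h : {ffun 'I_k.+1 -> 'I_4})
      ((2 * k.+1%:R)^-1 * (monomial_weight h * moment nu h)) * monomial h r.
Proof.
move=> nufin hr; rewrite -lee_fin.
have -> : (\sum_(h : {ffun 'I_k.+1 -> 'I_4})
      ((2 * k.+1%:R)^-1 * (monomial_weight h * moment nu h)) * monomial h r)%:E =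
  (\int[nu]_(s in sphere) (\sum_(h : {ffun 'I_k.+1 -> 'I_4})
    ((2 * k.+1%:R)^-1 * (monomial_weight h * monomial h r)) * monomial h s)%:E)%E.
  rewrite integral_lin_comb; last 2 first.
  - exact: measurable_sphere.
  - by move=> h; exact: integrable_monomial.
  by congr EFin; apply: eq_bigr => h _; rewrite -/(moment nu h); ring.
apply: integral_ge0 => s hs; rewrite lee_fin.
have -> : \sum_(h : {ffun 'I_k.+1 -> 'I_4})
    ((2 * k.+1%:R)^-1 * (monomial_weight h * monomial h r)) * monomial h s =
    (2 * k.+1%:R)^-1 * sphere_kernel r s ^+ k.+1.
  by rewrite sphere_kernelX mulr_sumr; apply: eq_bigr => h _; rewrite !mulrA.
by rewrite mulr_ge0 ?invr_ge0 ?mulr_ge0// exprn_ge0// sphere_kernel_ge0.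
Qed.

(** The potential is a series of nonnegative polynomials in r, which transfers their measurability
    to it. *)
Lemma measurable_potential nu : (nu sphere < +oo)%E ->
  measurable_fun sphere (fun r => \int[nu]_(s in sphere) coulomb r s)%E.
Proof.
move=> nufin.
apply: (@eq_measurable_fun _ _ _ _ _ (fun r => \sum_(0 <= k <oo)
    (\sum_(h : {ffun 'I_k.+1 -> 'I_4})
      ((2 * k.+1%:R)^-1 * (monomial_weight h * moment nu h)) * monomial h r)%:E)%E).
  by move=> r; rewrite inE => hr; rewrite potential_series.
apply: ge0_emeasurable_sum => [k r hr _|k _].
  by rewrite lee_fin power_potential_ge0.
apply/measurable_EFinP; apply: measurable_funTS; apply: measurable_sum => h.
by apply: measurable_funM; [exact: measurable_cst|exact: measurable_monomial].
Qed.

Lemma power_energy_ge0 mu nu k : (mu sphere < +oo)%E -> (nu sphere < +oo)%E ->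
  0 <= power_energy mu nu k.
Proof.
move=> mufin nufin; rewrite -lee_fin.
have -> : (power_energy mu nu k)%:E = (\int[mu]_(r in sphere)
   (\sum_(h : {ffun 'I_k.+1 -> 'I_4})
      ((2 * k.+1%:R)^-1 * (monomial_weight h * moment nu h)) * monomial h r)%:E)%E.
  rewrite integral_lin_comb; last 2 first.
  - exact: measurable_sphere.
  - by move=> h; exact: integrable_monomial.
  rewrite /power_energy mulr_sumr.
  by congr EFin; apply: eq_bigr => h _; rewrite -/(moment mu h); ring.
by apply: integral_ge0 => r hr; rewrite lee_fin power_potential_ge0.
Qed.

Lemma interaction_series mu nu : (mu sphere < +oo)%E -> (nu sphere < +oo)%E ->
  interaction mu nu = (\sum_(0 <= k <oo) (power_energy mu nu k)%:E)%E.
Proof.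
move=> mufin nufin; rewrite /interaction.
transitivity (\int[mu]_(r in sphere) (\sum_(0 <= k <oo)
    (\sum_(h : {ffun 'I_k.+1 -> 'I_4})
      ((2 * k.+1%:R)^-1 * (monomial_weight h * moment nu h)) * monomial h r)%:E))%E.
  by apply: eq_integral => r; rewrite inE => hr; rewrite potential_series.
rewrite integral_nneseries; last 3 first.
- exact: measurable_sphere.
- move=> k; apply/measurable_EFinP; apply: measurable_funTS; apply: measurable_sum => h.
  by apply: measurable_funM; [exact: measurable_cst|exact: measurable_monomial].
- by move=> k r hr; rewrite lee_fin power_potential_ge0.
apply: eq_eseriesr => k _.
rewrite integral_lin_comb; last 2 first.
- exact: measurable_sphere.
- by move=> h; exact: integrable_monomial.
rewrite /power_energy mulr_sumr.
by congr EFin; apply: eq_bigr => h _; rewrite -/(moment mu h); ring.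
Qed.

(** Symmetry is read off the products of moments, in place of exchanging two integrals of the
    singular kernel. *)
Lemma interaction_sym mu nu : (mu sphere < +oo)%E -> (nu sphere < +oo)%E ->
  interaction mu nu = interaction nu mu.
Proof.
move=> mufin nufin; rewrite !interaction_series//; apply: eq_eseriesr => k _.
congr EFin; congr (_ * _); apply: eq_bigr => h _.
by rewrite [moment mu h * _]mulrC.
Qed.

(** Termwise this is 2 x y <= x^2 + y^2 for the moments, with nonnegative weights. The mixed term is
    moved to the left because the self-interactions may be infinite. *)
Lemma interaction_positive_definite mu nu :
  (mu sphere < +oo)%E -> (nu sphere < +oo)%E ->
  (interaction mu nu + interaction mu nu <= interaction mu mu + interaction nu nu)%E.
Proof.
move=> mufin nufin; rewrite !interaction_series//.
rewrite -!nneseriesD; try by move=> k _ _; rewrite lee_fin power_energy_ge0.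
apply: lee_nneseries => k.
  by move=> _ _; rewrite -EFinD lee_fin addr_ge0 ?power_energy_ge0.
move=> _; rewrite -!EFinD lee_fin /power_energy -!mulrDr.
rewrite ler_wpM2l ?invr_ge0 ?mulr_ge0// -!big_split/=.
apply: ler_sum => h _; rewrite -!mulrDr ler_wpM2l ?monomial_weight_ge0//.
by have := sqr_ge0 (moment mu h - moment nu h); nra.
Qed.

End Measures.
End SphereKernel.

(** * Potentials of rings and caps *)

Section Density.
Context d1 d2 (X : measurableType d1) (Y : measurableType d2) (R : realType).
Variables (mu : {measure set X -> \bar R}) (m : {measure set Y -> \bar R}).
Variables (phi : X -> Y) (D : set X) (h : X -> R).
Hypotheses (mphi : measurable_fun setT phi) (mD : measurable D).
Hypotheses (mh : measurable_fun D h) (h0 : forall x, D x -> 0 <= h x).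
Hypothesis mE : forall U, measurable U ->
  m U = (\int[mu]_(x in D `&` phi @^-1` U) (h x)%:E)%E.

Import HBNNSimple.

(** The case of simple functions, where [mE] is applied on each level set; monotone convergence then
    extends it to nonnegative functions. *)
Lemma integral_density_nnsfun (f : {nnsfun Y >-> R}) :
  (\int[m]_y (f y)%:E = \int[mu]_(x in D) ((f (phi x))%:E * (h x)%:E))%E.
Proof.
have mpre k : measurable (phi @^-1` (f @^-1` [set k])).
  by rewrite -[X in measurable X]setTI; exact: mphi.
rewrite integralT_nnsfun sintegralE.
under eq_fsbigr do rewrite mE//.
transitivity (\sum_(k \in range f)
    \int[mu]_(x in D) ((k * \1_(phi @^-1` (f @^-1` [set k])) x)%:E * (h x)%:E))%E.
  apply: eq_fsbigr => k; rewrite inE => -[y _ fy].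
  have k0 : 0 <= k by rewrite -fy.
  under [RHS]eq_integral do rewrite EFinM -muleA.
  rewrite ge0_integralZl_EFin//; first last.
  - apply: emeasurable_funM; last exact/measurable_EFinP.
    by apply/measurable_EFinP; apply: measurable_indic.
  - by move=> x Dx; rewrite mule_ge0// lee_fin// h0.
  congr (_ * _)%E; rewrite integral_mkcondr; apply: eq_integral => x _.
  by rewrite patchE indicE; case: ifPn => _; rewrite ?mul1e ?mul0e.
rewrite -ge0_integral_fsum//.
- apply: eq_integral => x _; rewrite [in RHS]fimfunE -fsumEFin// ge0_mule_fsuml//.
  by move=> k; exact: nnfun_muleindic_ge0.
- move=> k; apply: emeasurable_funM; last exact/measurable_EFinP.
  apply/measurable_EFinP; apply: measurable_funM; first exact: measurable_cst.
  exact: measurable_indic.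
- move=> k x Dx; rewrite mule_ge0 ?lee_fin ?h0//.
  have := nnfun_muleindic_ge0 f k (phi x); rewrite lee_fin; apply.
Qed.

Lemma ge0_integral_density (f : Y -> \bar R) : (forall y, (0 <= f y)%E) ->
  measurable_fun setT f ->
  (\int[m]_y f y = \int[mu]_(x in D) (f (phi x) * (h x)%:E))%E.
Proof.
move=> f0 mf; pose g := nnsfun_approx measurableT mf.
have gf y : (g n y)%:E @[n --> \oo] --> f y by exact: cvg_nnsfun_approx.
have g_nd y : {homo (fun n => (g n y)%:E) : m n / (m <= n)%N >-> (m <= n)%E}.
  by move=> a b ab; rewrite lee_fin; exact/lefP/nd_nnsfun_approx.
transitivity (limn (fun n => \int[m]_y (g n y)%:E))%E.
  rewrite -monotone_convergence//.
  - by apply: eq_integral => y _; apply/esym/cvg_lim.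
  - by move=> n; exact/measurable_EFinP.
  - by move=> n y _; rewrite lee_fin.
under eq_fun do rewrite integral_density_nnsfun.
rewrite -monotone_convergence//.
- apply: eq_integral => x; rewrite inE => Dx; apply/cvg_lim => //.
  apply: cvgeZr => //; exact: gf.
- move=> n; apply: emeasurable_funM; last exact/measurable_EFinP.
  apply/measurable_EFinP; apply: measurable_funTS.
  by apply: measurableT_comp.
- by move=> n x Dx; rewrite mule_ge0// lee_fin// h0.
- by move=> x Dx a b ab; rewrite lee_wpmul2r// ?lee_fin ?h0//; exact: g_nd.
Qed.

End Density.

Section ProductRectangle.
Context {R : realType}.
Notation mu := (@lebesgue_measure R).

Lemma integral_rectangle (I J : set R) (f : R * R -> \bar R) :
  measurable I -> measurable J -> measurable_fun (I `*` J) f ->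
  (forall u, (I `*` J) u -> (0 <= f u)%E) ->
  (\int[mu \x mu]_(u in I `*` J) f u =
   \int[mu]_(y in J) \int[mu]_(x in I) f (x, y))%E.
Proof.
move=> mI mJ mf f0.
have mIJ : measurable (I `*` J) by exact: measurableX.
rewrite integral_mkcond fubini_tonelli2//; last 2 first.
- exact/(measurable_restrictT _ mIJ).
- by move=> u; apply: erestrict_ge0.
rewrite [RHS]integral_mkcond; apply: eq_integral => y _.
rewrite /fubini_G [RHS]patchE; case: ifPn => yJ.
  rewrite [RHS]integral_mkcond; apply: eq_integral => x _.
  rewrite /= !patchE; congr (if _ then _ else _).
  apply/idP/idP; rewrite !inE; first by case.
  by move=> Ix; split => //=; rewrite inE in yJ.
rewrite integral0_eq// => x _; rewrite patchE; case: ifPn => //.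
by rewrite inE => -[_ /= Jy]; move: yJ; rewrite notin_setE.
Qed.

End ProductRectangle.

(** * Mean potential of a circle of latitude *)

Section Azimuth.
Context {R : realType}.
Notation mu := (@lebesgue_measure R).
Implicit Types r s : space3 R.

Lemma sphere_sphere_point (u : R * R) : sphere (sphere_point u).
Proof.
apply/sphereE; rewrite /sphere_point/=.
have h1 := cos2Dsin2 u.1; have h2 := cos2Dsin2 u.2.
transitivity (4^-1 * (sin u.2 ^+ 2 * (cos u.1 ^+ 2 + sin u.1 ^+ 2) + cos u.2 ^+ 2)).
  by field.
by rewrite h1 mulr1 addrC h2 mulr1.
Qed.

Lemma sphere_height r : sphere r -> -1 <= 2 * r.2 <= 1.
Proof.
move=> /sphereE h; have h1 := sqr_ge0 r.1.1; have h2 := sqr_ge0 r.1.2.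
by apply/andP; split; nra.
Qed.

(** Twice the Coulomb potential of a unit charge at the south pole: (1 + c) / 2 is the squared
    distance from there to a point whose polar angle has cosine c. *)
Definition circle_log (c : R) : R := - ln ((1 + c) / 2).

(* Twice the mean Coulomb potential of a circle of latitude; c and c' are the
   cosines of the polar angles of the point and of the circle. *)
Definition latitude_potential (c c' : R) : R :=
  circle_log (Num.max c c') + circle_log (- Num.min c c').

(** Along the circle the squared distance to r is B |e^(ix) - w|^2 with |w| <= 1, so its mean
    logarithm is ln B. When r lies on the circle itself |w| = 1, which is where the closed disc is
    required. *)
Lemma integral_azimuth r (t : R) : sphere r -> 0 < sin t ->
  (\int[mu]_(p in `[0%R, (2 * pi)%R]) coulomb r (sphere_point (p, t)) =
   (pi * latitude_potential (2 * r.2) (cos t))%:E)%E.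
Proof.
move=> hr st0; have /andP[c1 c2] := sphere_height hr.
set c := 2 * r.2 in c1 c2 *.
have hc := cos2Dsin2 t.
have ct : -1 < cos t < 1.
  have : cos t ^+ 2 < 1 by nra.
  by move=> h; apply/andP; split; nra.
move: ct => /andP[ct1 ct2].
pose M := Num.max c (cos t); pose m := Num.min c (cos t).
have mM : m <= M by rewrite /m /M ge_min le_max lexx.
have M1 : 0 < 1 + M by rewrite -ltrBlDl sub0r lt_max ct1 orbT.
have m1 : 0 < 1 - m by rewrite subr_gt0 gt_min ct2 orbT.
have Mm : M * m = c * cos t.
  by rewrite /M /m; case: leP => _; rewrite // mulrC.
have Mm2 : (1 - M ^+ 2) * (1 - m ^+ 2) = (1 - c ^+ 2) * (1 - cos t ^+ 2).
  by rewrite /M /m; case: leP => _; rewrite // mulrC.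
(* B and B |w|^2 must have sum (1 - c cos t) / 2 and product (1 - c^2) (1 - cos^2 t) / 16. Sorting
   the two cosines into M and m makes B the larger solution, whence |w| <= 1. *)
pose B := (1 + M) * (1 - m) / 4.
have B0 : 0 < B by rewrite divr_gt0// mulr_gt0.
pose p := sin t * r.1.1 / (2 * B); pose q := sin t * r.1.2 / (2 * B).
have pqE : B * (p ^+ 2 + q ^+ 2) = (1 - M) * (1 + m) / 4.
  have e1 : sin t ^+ 2 = 1 - cos t ^+ 2 by rewrite -hc addrAC subrr add0r.
  have e2 : r.1.1 ^+ 2 + r.1.2 ^+ 2 = (1 - c ^+ 2) / 4.
    by move/sphereE : hr => h; rewrite /c; lra.
  have -> : B * (p ^+ 2 + q ^+ 2) = (r.1.1 ^+ 2 + r.1.2 ^+ 2) * sin t ^+ 2 / (4 * B).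
    by rewrite /p /q; field; rewrite gt_eqF.
  rewrite e1 e2; transitivity ((1 - c ^+ 2) * (1 - cos t ^+ 2) / (16 * B)).
    by field; rewrite gt_eqF.
  rewrite -Mm2 /B.
  by field; rewrite !gt_eqF.
have pq1 : p ^+ 2 + q ^+ 2 <= 1.
  by rewrite -(ler_pM2l B0) mulr1 pqE /B ler_pM2r ?invr_gt0//; nra.
have kE x : 1 - sphere_kernel r (sphere_point (x, t)) = B * circle_dist2 p q x.
  rewrite /circle_dist2 mulrBr mulrDr mulr1 pqE.
  have -> : B * (2 * (p * cos x + q * sin x)) =
      sin t * (r.1.1 * cos x + r.1.2 * sin x).
    by rewrite /p /q; field; rewrite gt_eqF.
  have -> : B + (1 - M) * (1 + m) / 4 = (1 - c * cos t) / 2.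
    by rewrite -Mm /B; field.
  by rewrite /sphere_kernel /sphere_point/= /c; field.
have B1 x : B * circle_dist2 p q x <= 1.
  by rewrite -kE gerBl sphere_kernel_ge0//; exact: sphere_sphere_point.
transitivity (\int[mu]_(x in `[0%R, (2 * pi)%R])
    ((2^-1)%:E * - lne (B * circle_dist2 p q x)%:E))%E.
  apply: eq_integral => x _; rewrite coulombE ?kE//; exact: sphere_sphere_point.
rewrite ge0_integralZl_EFin//; last 2 first.
- by move=> x _; rewrite oppe_ge0 lne_le0 lee_fin.
- exact: measurable_lne_circle_dist2.
rewrite integral_lne_circle_dist2// -EFinM; congr EFin.
rewrite /latitude_potential /circle_log -/M -/m.
have -> : ln B = ln ((1 + M) / 2) + ln ((1 - m) / 2).
  by rewrite -lnM ?posrE ?divr_gt0//; congr ln; rewrite /B; field.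
by field.
Qed.

End Azimuth.

(** * Potential of a spherical cap *)

Section CapPotential.
Context {R : realType}.
Notation mu := (@lebesgue_measure R).
Implicit Types r s : space3 R.

Lemma measurable_circle_log : measurable_fun setT (@circle_log R).
Proof.
apply: measurableT_comp => //; apply: measurableT_comp => //.
apply: measurable_funM; last exact: measurable_cst.
by apply: measurable_funD; [exact: measurable_cst|exact: measurable_id].
Qed.

Lemma circle_log_ge0 (c : R) : c <= 1 -> 0 <= circle_log c.
Proof. by move=> c1; rewrite oppr_ge0 ln_le0//; lra. Qed.

Lemma latitude_potential_ge0 (c c' : R) : -1 <= c <= 1 -> -1 <= c' <= 1 ->
  0 <= latitude_potential c c'.
Proof.
move=> /andP[c1 c2] /andP[c3 c4]; rewrite addr_ge0// circle_log_ge0//.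
  by rewrite ge_max c2.
by rewrite lerNl le_min c1.
Qed.

Lemma measurable_latitude_potential (c : R) :
  measurable_fun setT (fun t => sin t * latitude_potential c (cos t)).
Proof.
have mc : measurable_fun setT (@cos R).
  by apply: continuous_measurable_fun => x; exact: continuous_cos.
have ms : measurable_fun setT (@sin R).
  by apply: continuous_measurable_fun => x; exact: continuous_sin.
apply: measurable_funM => //; apply: measurable_funD.
  apply: (measurableT_comp measurable_circle_log).
  by apply: measurable_maxr => //; exact: measurable_cst.
apply: (measurableT_comp measurable_circle_log).
apply: measurableT_comp => //.
by apply: measurable_minr => //; exact: measurable_cst.
Qed.

Let xlnx (x : R) := x * ln x.

Lemma cos_antitone (s t : R) : 0 <= s -> s <= t -> t <= pi -> cos t <= cos s.
Proof.
move=> s0; rewrite le_eqVlt => /predU1P[->//|st] tpi.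
by apply: ltW; rewrite ltr_cos// in_itv/=; apply/andP; split; lra.
Qed.

(** The point lies below every circle of the band, which settles the maximum and minimum in
    [latitude_potential]: its own term is constant and the circles' terms have an elementary
    primitive. *)
Lemma polar_integral_below (c s t : R) : 0 <= s -> s <= t -> t <= pi ->
  c <= cos t ->
  (\int[mu]_(x in `[s, t]) (sin x * latitude_potential c (cos x))%:E =
   (polar_primitive false t - polar_primitive false s +
    circle_log (- c) * (cos s - cos t))%:E)%E.
Proof.
move=> s0 st tpi ct; rewrite -integral_sin_log_cos//.
apply: eq_integral => x; rewrite inE/= in_itv/= => /andP[sx xt]; congr EFin.
have cx : c <= cos x by apply: (le_trans ct); apply: cos_antitone => //; lra.
rewrite /latitude_potential max_r// min_l// /circle_log expr0 mul1r.
by [].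
Qed.

Lemma polar_integral_above (c s t : R) : 0 <= s -> s <= t -> t <= pi ->
  cos s <= c ->
  (\int[mu]_(x in `[s, t]) (sin x * latitude_potential c (cos x))%:E =
   (polar_primitive true t - polar_primitive true s +
    circle_log c * (cos s - cos t))%:E)%E.
Proof.
move=> s0 st tpi ct; rewrite -integral_sin_log_cos//.
apply: eq_integral => x; rewrite inE/= in_itv/= => /andP[sx xt]; congr EFin.
have cx : cos x <= c by apply: le_trans ct; apply: cos_antitone => //; lra.
rewrite /latitude_potential max_l// min_r// /circle_log expr1 mulN1r addrC.
by [].
Qed.

(* Four times the potential of the background charge of the cap of points with
   cosine of the polar angle at least a. *)
Definition cap_potential (a c : R) : R :=
  if c <= a then (1 - a) + 2 * xlnx ((1 + a) / 2) + (1 - a) * circle_log (- c)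
  else - (1 + a) * circle_log c + (1 - a) - 2 * xlnx ((1 - a) / 2).

Lemma cap_integral (a c : R) : -1 <= a <= 1 -> -1 <= c <= 1 ->
  (\int[mu]_(x in `[0%R, acos a]) (sin x * latitude_potential c (cos x))%:E =
   (cap_potential a c)%:E)%E.
Proof.
move=> /andP[a0 a1] /andP[c0 c1].
have aE : cos (acos a) = a by rewrite acosK// in_itv/= a0.
have cE : cos (acos c) = c by rewrite acosK// in_itv/= c0.
have a_ge0 : 0 <= acos a by rewrite acos_ge0// a0.
have a_pi : acos a <= pi by rewrite acos_lepi// a0.
have c_ge0 : 0 <= acos c by rewrite acos_ge0// c0.
have c_pi : acos c <= pi by rewrite acos_lepi// c0.
rewrite /cap_potential; case: ifPn => [ca|]; last rewrite -ltNge => ac.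
  rewrite polar_integral_below ?aE//; congr EFin.
  rewrite /polar_primitive cos0 aE expr0 !mul1r.
  have -> : (1 + 1) / 2 = 1 :> R by field.
  rewrite ln1 /xlnx; set l := ln _; set m := circle_log _; by field.
have ca : acos c <= acos a.
  by rewrite leNgt; apply/negP => h; have := @cos_antitone _ _ a_ge0 (ltW h) c_pi; rewrite aE cE; lra.
pose F t : \bar R := (sin t * latitude_potential c (cos t))%:E.
have mF D : measurable_fun D F.
  by apply: measurable_funTS; apply/measurable_EFinP; exact: measurable_latitude_potential.
have F0 t : t \in `[0, pi] -> (0 <= F t)%E.
  move=> /[!in_itv]/= tpi; rewrite lee_fin mulr_ge0 ?sin_ge0_pi//.
  by rewrite latitude_potential_ge0 ?c0 ?c1// cos_geN1 cos_le1.
(* The point lies inside the cap, so the band is cut at its own latitude, where the maximum and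
   minimum change roles. *)
have -> : `[0, acos a]%classic = `[0, acos c]%classic `|` `]acos c, acos a]%classic.
  apply/seteqP; split => x; rewrite /= !in_itv/=.
    by move=> /andP[x0 xa]; case: (leP x (acos c)) => xc; [left|right]; rewrite ?x0 ?xa.
  by case=> /andP[x1 x2]; apply/andP; split; lra.
rewrite ge0_integral_setU//; last 3 first.
- exact: mF.
- move=> x [|]; rewrite /= in_itv/= => /andP[x1 x2]; apply: F0; rewrite in_itv/=;
  by apply/andP; split; lra.
- apply/disj_setPS => x [/=]; rewrite !in_itv/= => /andP[_ h1] /andP[h2 _].
  by move: (lt_le_trans h2 h1); rewrite ltxx.
rewrite integral_itv_obnd_cbnd//.
rewrite (@polar_integral_below c 0 (acos c)) ?cE//.
rewrite (@polar_integral_above c (acos c) (acos a)) ?cE// -EFinD; congr EFin.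
rewrite /polar_primitive cos0 aE cE expr0 expr1 !mul1r !mulN1r.
have -> : (1 + 1) / 2 = 1 :> R by field.
have hw : (1 - c) * circle_log (- c) = - 2 * xlnx ((1 - c) / 2).
  by rewrite /circle_log /xlnx; field.
have hy : ln ((1 + c) / 2) = - circle_log c by rewrite /circle_log opprK.
have -> : circle_log (- c) * (1 - c) = - 2 * xlnx ((1 - c) / 2) by rewrite mulrC hw.
rewrite hy ln1 /xlnx; set l := ln ((1 - c) / 2); set m := circle_log _; set k := ln _.
by field.
Qed.

Definition cap_angles (a : R) : set (R * R) := `[0, 2 * pi] `*` `[0, acos a].

Lemma coulomb_cap (a : R) r : -1 <= a <= 1 -> sphere r ->
  (\int[mu \x mu]_(u in cap_angles a)
     (coulomb r (sphere_point u) * (2^-1 ^+ 2 * sin u.2)%:E) =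
   (pi / 4 * cap_potential a (2 * r.2))%:E)%E.
Proof.
move=> a1 hr; have a1' := a1; case/andP: a1' => a2 a3.
have a_pi : acos a <= pi by rewrite acos_lepi.
have hc := sphere_height hr.
have msin : measurable_fun setT (@sin R).
  by apply: continuous_measurable_fun => x; exact: continuous_sin.
have mcs : measurable_fun setT (fun u : R * R => coulomb r (sphere_point u)).
  apply: (@measurable_comp _ _ _ _ _ _ sphere) => //.
  - exact: measurable_sphere.
  - by move=> _ [u _ <-]; exact: sphere_sphere_point.
  - exact: measurable_coulomb.
  - exact: measurable_sphere_point.
have s0 (t : R) : t \in `[0, acos a] -> 0 <= sin t.
  rewrite in_itv/= => /andP[t0 ta]; apply: sin_ge0_pi; apply/andP; split; lra.
rewrite integral_rectangle//; last 2 first.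
- apply: measurable_funTS; apply: emeasurable_funM => //.
  apply/measurable_EFinP; apply: measurable_funM; first exact: measurable_cst.
  by apply: measurableT_comp.
- move=> u [_ /= u2]; rewrite mule_ge0 ?coulomb_ge0//; first exact: sphere_sphere_point.
  by rewrite lee_fin mulr_ge0// ?exprn_ge0// s0.
transitivity (\int[mu]_(t in `[0%R, acos a]) ((pi / 4)%:E *
   (sin t * latitude_potential (2 * r.2) (cos t))%:E))%E.
  apply: eq_integral => t; rewrite inE/= => ta; have := s0 _ ta.
  (* At the poles the circle degenerates and [integral_azimuth] does not apply, but the area element
     vanishes there. *)
  rewrite le_eqVlt => /predU1P[<-|st].
    rewrite !mulr0 mul0r mule0 integral0_eq// => x _.
    by rewrite mule0.
  under eq_integral do rewrite muleC.
  rewrite ge0_integralZl_EFin//; first last.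
  - by rewrite mulr_ge0 ?exprn_ge0// ltW.
  - apply: measurable_funTS; apply: (measurableT_comp mcs).
    exact: pair2_measurable.
  - by move=> x _; rewrite coulomb_ge0//; exact: sphere_sphere_point.
  rewrite integral_azimuth// -!EFinM; congr EFin; by field.
rewrite ge0_integralZl_EFin//; first last.
- by rewrite divr_ge0// pi_ge0.
- by apply/measurable_EFinP; apply: measurable_funTS; exact: measurable_latitude_potential.
- move=> t ta; rewrite lee_fin mulr_ge0// ?s0// latitude_potential_ge0//.
  by rewrite cos_geN1 cos_le1.
by rewrite cap_integral// -EFinM.
Qed.

End CapPotential.

(** * Measures given by a density along a parametrisation *)

Section ImageDensity.
Context d1 d2 (X : measurableType d1) (Y : measurableType d2) (R : realType).
Variables (mu : {measure set X -> \bar R}) (phi : X -> Y) (D : set X) (h : X -> R).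
Hypotheses (mphi : measurable_fun setT phi) (mD : measurable D).
Hypotheses (mh : measurable_fun D h) (h0 : forall x, D x -> 0 <= h x).

(** The hypotheses are arguments of the definition so that the measure structure can be declared on
    it once and for all. *)
Definition image_density of measurable_fun setT phi & measurable D &
    measurable_fun D h & (forall x, D x -> 0 <= h x) :=
  fun U : set Y => (\int[mu]_(x in D `&` phi @^-1` U) (h x)%:E)%E.

Local Notation m := (image_density mphi mD mh h0).

Let m0 : m set0 = 0%E.
Proof. by rewrite /image_density preimage_set0 setI0 integral_set0. Qed.

Let m_ge0 U : (0 <= m U)%E.
Proof. by apply: integral_ge0 => x [Dx _]; rewrite lee_fin h0. Qed.

Let m_sigma_additive : semi_sigma_additive m.
Proof.
move=> F mF tF mUF; rewrite /image_density preimage_bigcup setI_bigcupr.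
rewrite ge0_integral_bigcup//=.
- apply: is_cvg_ereal_nneg_natsum_cond => n _ _.
  by apply: integral_ge0 => x [Dx _]; rewrite lee_fin h0.
- move=> n; apply: measurableI => //.
  by rewrite -[X in measurable X]setTI; exact: mphi.
- apply/measurable_EFinP; apply: measurable_funS mh => //.
  by move=> x [n _ []].
- by move=> x [n _ [Dx _]]; rewrite lee_fin h0.
- move=> i j _ _ [x [[_ Fi] [_ Fj]]]; apply: tF => //.
  by exists (phi x).
Qed.

HB.instance Definition _ := isMeasure.Build _ _ _ m m0 m_ge0 m_sigma_additive.

Lemma ge0_integral_image_density (D' : set Y) (f : Y -> \bar R) :
  measurable D' -> measurable_fun D' f -> (forall y, D' y -> (0 <= f y)%E) ->
  (forall x, D' (phi x)) ->
  (\int[m]_(y in D') f y = \int[mu]_(x in D) (f (phi x) * (h x)%:E))%E.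
Proof.
move=> mD' mf f0 phiD'; rewrite [LHS]integral_mkcond.
have mE U : measurable U -> m U = (\int[mu]_(x in D `&` phi @^-1` U) (h x)%:E)%E by [].
transitivity (\int[mu]_(x in D) ((f \_ D') (phi x) * (h x)%:E))%E.
  apply: (ge0_integral_density mphi mD mh h0 mE).
  - by move=> y; apply: erestrict_ge0.
  - exact/(measurable_restrictT _ mD').
by apply: eq_integral => x _; rewrite patchE mem_set.
Qed.

End ImageDensity.

(** Charge configurations are pairs of bundled finite measures; restricting to the whole space
    supplies that bundle without changing any value. *)
Lemma finite_measure_ex d (T : measurableType d) (R : realType)
    (m : {measure set T -> \bar R}) : (m setT < +oo)%E ->
  exists m' : {finite_measure set T -> \bar R}, forall U, m' U = m U.
Proof.
move=> moo; exists (mfrestr measurableT moo) => U.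
by rewrite -[RHS](congr1 m (setIT U)).
Qed.

(** * The caps and the background as measures *)

Section Minimizer.
Context {R : realType}.
Notation mu := (@lebesgue_measure R).
Implicit Types r s : space3 R.

Lemma integral_sin (s t : R) : s <= t ->
  (\int[mu]_(x in `[s, t]) (sin x)%:E = (cos s - cos t)%:E)%E.
Proof.
rewrite le_eqVlt => /predU1P[->|st]; first by rewrite set_itv1 integral_set1 subrr.
have cc : continuous (fun x : R => - cos x).
  by move=> x; apply: cvgN; exact: continuous_cos.
rewrite (@continuous_FTC2 _ _ (fun x => - cos x))//.
- by rewrite -EFinB; congr EFin; ring.
- by apply: continuous_subspaceT; exact: continuous_sin.
- split.
  + by move=> x _; apply: derivableN; exact: derivable_cos.
  + by apply: cvg_at_right_filter; exact: cc.
  + by apply: cvg_at_left_filter; exact: cc.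
- move=> x _; rewrite derive1E deriveN; last exact: derivable_cos.
  by rewrite derive_val opprK.
Qed.

Lemma measurable_cap_angles (a : R) : measurable (cap_angles a).
Proof. exact: measurableX. Qed.

Definition area_density (u : R * R) : R := pi^-1 * (2^-1 ^+ 2 * sin u.2).

Lemma measurable_area_density D : measurable_fun D area_density.
Proof.
apply: measurable_funTS; apply: measurable_funM => //.
apply: measurable_funM => //; apply: measurableT_comp => //.
by apply: continuous_measurable_fun => x; exact: continuous_sin.
Qed.

Lemma area_density_ge0 (a : R) (u : R * R) : -1 <= a <= 1 -> cap_angles a u ->
  0 <= area_density u.
Proof.
move=> a1 [_ /=]; rewrite in_itv/= => /andP[u0 ua].
rewrite mulr_ge0 ?invr_ge0 ?pi_ge0// mulr_ge0 ?exprn_ge0 ?invr_ge0//.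
by rewrite sin_ge0_pi// u0 (le_trans ua)// acos_lepi.
Qed.

(** With [b] true the angles of the upper cap parametrise the lower one, so one rectangle of angles
    serves both caps. *)
Definition mirror_point (b : bool) (u : R * R) : space3 R :=
  if b then reflect_equator (sphere_point u) else sphere_point u.

Lemma reflect_equatorK : involutive (@reflect_equator R).
Proof. by move=> [[x y] z]; rewrite /reflect_equator/= opprK. Qed.

Lemma sphere_reflect r : sphere r -> sphere (reflect_equator r).
Proof. by move=> /sphereE h; apply/sphereE; rewrite /= sqrrN. Qed.

Lemma sphere_mirror_point b u : sphere (mirror_point b u).
Proof.
by case: b; [apply: sphere_reflect|]; exact: sphere_sphere_point.
Qed.

Lemma measurable_reflect : measurable_fun setT (@reflect_equator R).
Proof.
apply: measurable_fun_pair; first apply: measurable_fun_pair.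
- by apply: measurableT_comp => //; exact: measurable_fst.
- by apply: measurableT_comp => //; exact: measurable_fst.
- by apply: measurableT_comp => //; exact: measurable_snd.
Qed.

Lemma measurable_mirror_point b : measurable_fun setT (mirror_point b).
Proof.
case: b; last exact: measurable_sphere_point.
exact: (measurableT_comp measurable_reflect measurable_sphere_point).
Qed.

Lemma coulomb_reflect r s : coulomb r (reflect_equator s) = coulomb (reflect_equator r) s.
Proof.
rewrite /coulomb /euclid_dist/=; congr (- lne (Num.sqrt _)%:E)%E.
by congr (_ + _); ring.
Qed.

Section Cap.
Variables (a : R) (a1 : -1 <= a <= 1).

Definition cap_measure (b : bool) : {measure set space3 R -> \bar R} :=
  image_density (mu \x mu)%E (measurable_mirror_point b) (measurable_cap_angles a)
    (@measurable_area_density _) (fun u => @area_density_ge0 a u a1).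

Lemma cap_measure_potential b r : sphere r ->
  (\int[cap_measure b]_(s in sphere) coulomb r s =
   (4^-1 * cap_potential a ((-1) ^+ b * (2 * r.2)))%:E)%E.
Proof.
move=> hr; rewrite ge0_integral_image_density; last 4 first.
- exact: measurable_sphere.
- exact: measurable_coulomb.
- by move=> s; exact: coulomb_ge0.
- exact: sphere_mirror_point.
pose r' := if b then reflect_equator r else r.
have hr' : sphere r' by rewrite /r'; case: (b) => //; exact: sphere_reflect.
transitivity (\int[mu \x mu]_(u in cap_angles a) ((pi^-1)%:E *
    (coulomb r' (sphere_point u) * (2^-1 ^+ 2 * sin u.2)%:E)))%E.
  apply: eq_integral => u _; rewrite /area_density EFinM muleCA; congr (_ * (_ * _))%E.
  by rewrite /r' /mirror_point; case: (b) => //; rewrite coulomb_reflect.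
have hs : 0 <= (pi^-1 : R) by rewrite invr_ge0 pi_ge0.
rewrite ge0_integralZl_EFin//; last 3 first.
- exact: measurable_cap_angles.
- move=> u /(area_density_ge0 a1); rewrite /area_density pmulr_rge0 ?invr_gt0 ?pi_gt0// => h.
  by rewrite mule_ge0// coulomb_ge0//; exact: sphere_sphere_point.
- apply: measurable_funTS; apply: emeasurable_funM.
    apply: (@measurable_comp _ _ _ _ _ _ sphere) => //.
    + exact: measurable_sphere.
    + by move=> _ [u _ <-]; exact: sphere_sphere_point.
    + exact: measurable_coulomb.
    + exact: measurable_sphere_point.
  apply/measurable_EFinP; apply: measurable_funM => //; apply: measurableT_comp => //.
  by apply: continuous_measurable_fun => x; exact: continuous_sin.
rewrite coulomb_cap// -EFinM; congr EFin.
have -> : 2 * r'.2 = (-1) ^+ b * (2 * r.2).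
  by rewrite /r'; case: (b); rewrite ?expr1 ?mulN1r ?mulrN// expr0 mul1r.
have : (pi : R) != 0 by rewrite gt_eqF ?pi_gt0.
by move: (pi : R) (cap_potential _ _) => p q p0; field.
Qed.

(** Archimedes: the area of a cap is proportional to its height. Allowing any U that contains the
    cap covers the sphere, the whole space and [polar_region] at once. *)
Lemma cap_measureE b U : (forall u, cap_angles a u -> U (mirror_point b u)) ->
  cap_measure b U = ((1 - a) / 2)%:E.
Proof.
move=> hU; have /andP[a2 a3] := a1.
rewrite /cap_measure/= /image_density (_ : _ `&` _ = cap_angles a); last first.
  by apply/seteqP; split => [u []//|u au]; split => //=; exact: hU.
have pi0 : (pi : R) != 0 by rewrite gt_eqF ?pi_gt0.
have api : acos a <= pi by rewrite acos_lepi.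
have a0 : 0 <= acos a by rewrite acos_ge0.
have s0 (t : R) : t \in `[0, acos a] -> 0 <= sin t.
  rewrite in_itv/= => /andP[t0 ta]; apply: sin_ge0_pi; apply/andP; split; lra.
rewrite integral_rectangle//; last 2 first.
- by apply/measurable_EFinP; exact: measurable_area_density.
- by move=> u /(area_density_ge0 a1); rewrite lee_fin.
transitivity (\int[mu]_(t in `[0%R, acos a]) ((2^-1)%:E * (sin t)%:E))%E.
  apply: eq_integral => t _.
  rewrite (@integral_cst _ _ _ mu _ _ (pi^-1 * (2^-1 ^+ 2 * sin t))%:E)//.
  transitivity ((pi^-1 * (2^-1 ^+ 2 * sin t))%:E * (2 * pi)%:E)%E.
    by congr (_ * _)%E; exact: lebesgue_measure_circle.
  rewrite -!EFinM; congr EFin; move: pi0 (sin t).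
  by move: (pi : R) => p p0 q; field.
rewrite ge0_integralZl_EFin//; last first.
  apply/measurable_EFinP; apply: measurable_funTS.
  by apply: continuous_measurable_fun => x; exact: continuous_sin.
rewrite integral_sin// -EFinM cos0 acosK ?in_itv/= ?a2//; congr EFin; by field.
Qed.

Lemma cap_measure0 b U : (forall u, cap_angles a u -> ~ U (mirror_point b u)) ->
  cap_measure b U = 0%E.
Proof.
move=> hU; rewrite /cap_measure/= /image_density (_ : _ `&` _ = set0) ?integral_set0//.
by apply/seteqP; split => u // -[au]; exact: hU.
Qed.

Lemma cap_measure_reflect b U :
  cap_measure b (reflect_equator @^-1` U) = cap_measure (~~ b) U.
Proof.
rewrite /cap_measure/= /image_density; congr (integral _ (_ `&` _) _).
apply/seteqP; split => u; rewrite /preimage/= /mirror_point; case: b => //=;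
  by rewrite reflect_equatorK.
Qed.

End Cap.

Lemma bounds_N1 : -1 <= (-1 : R) <= 1. Proof. by apply/andP; split; lra. Qed.

(** For a = -1 the cap is the whole sphere, so the mass and the potential of the background become
    instances of the cap computations. *)
Lemma backgroundE U : measurable U -> background U = cap_measure bounds_N1 false U.
Proof.
move=> mU; rewrite /background/= /mscale/= /sphere_area /cap_measure/= /image_density.
have e : acos (-1 : R) = pi by exact: acosN1.
have -> : cap_angles (-1 : R) = angles by rewrite /cap_angles /angles e.
rewrite -ge0_integralZl_EFin//; first last.
- by rewrite invr_ge0 pi_ge0.
- apply/measurable_EFinP; apply: measurable_funTS.
  apply: measurable_funM => //; apply: measurableT_comp => //.
  by apply: continuous_measurable_fun => x; exact: continuous_sin.
- move=> u [[_ /=]]; rewrite in_itv/= => u2 _.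
  by rewrite lee_fin mulr_ge0 ?exprn_ge0 ?invr_ge0// sin_ge0_pi.
- apply: measurableI; first exact: measurable_angles.
  by rewrite -[X in measurable X]setTI; exact: measurable_sphere_point.
Qed.

Lemma cap_potential_N1 (c : R) : -1 <= c -> cap_potential (-1) c = 2.
Proof.
move=> c1; rewrite /cap_potential subrr opprK oppr0 !mul0r add0r.
have e : (1 + 1) / 2 = 1 :> R by field.
case: ifPn => [c2|_].
  have -> : c = -1 by lra.
  by rewrite opprK /circle_log e ln1 oppr0 !mulr0 !addr0; ring.
by rewrite e ln1 !mulr0 subr0; ring.
Qed.

Lemma background_potential r : sphere r ->
  (\int[background]_(s in sphere) coulomb r s = (2^-1)%:E)%E.
Proof.
move=> hr; rewrite (@eq_measure_integral _ _ _ _ (cap_measure bounds_N1 false)); last first.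
  by move=> U mU _; exact: backgroundE.
have /andP[c1 _] := sphere_height hr.
rewrite cap_measure_potential// expr0 mul1r cap_potential_N1//; congr EFin; by field.
Qed.

Lemma background_sphere : background sphere = (1 : R)%:E.
Proof.
rewrite backgroundE; last exact: measurable_sphere.
rewrite cap_measureE; first by congr EFin; field.
by move=> u _; exact: sphere_mirror_point.
Qed.

End Minimizer.

(** * Closed forms of the equilibrium potential and energy *)

Section EquilibriumPotential.
Context {R : realType}.
Implicit Types a c : R.

Let xlnx (x : R) := x * ln x.

(** By reflection, the lower cap acts at height c as the upper one acts at -c. *)
Definition equilibrium_potential a c : R :=
  a / 2 * latitude_potential c 0 + 4^-1 * cap_potential a c + 4^-1 * cap_potential a (- c).

Definition equator_potential a : R :=
  a / 2 * ln 2 + (1 - a) / 2 + xlnx ((1 + a) / 2) + ln 2 / 2.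

Definition polar_potential a : R :=
  a / 2 * ln 2 + (1 - a) / 2 + (xlnx ((1 + a) / 2) - xlnx ((1 - a) / 2)) / 2.

Lemma circle_log0 : circle_log (0 : R) = ln 2.
Proof. by rewrite /circle_log addr0 div1r lnV ?posrE// opprK. Qed.

Lemma latitude_potential0 c : 0 <= c -> latitude_potential c 0 = circle_log c + ln 2.
Proof. by move=> c0; rewrite /latitude_potential max_l// min_r// oppr0 circle_log0. Qed.

Lemma equilibrium_potentialN a c : equilibrium_potential a (- c) = equilibrium_potential a c.
Proof.
have latN (x : R) : latitude_potential (- x) 0 = latitude_potential x 0.
  wlog x0 : x / 0 <= x => [hw|].
    case: (leP 0 x) => [|/ltW x0]; first exact: hw.
    have xN : 0 <= - x by rewrite oppr_ge0.
    by rewrite -[in RHS](opprK x) (hw _ xN).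
  rewrite [RHS]latitude_potential0// /latitude_potential.
  by rewrite max_r ?oppr_le0// min_l ?oppr_le0// opprK circle_log0 addrC.
by rewrite /equilibrium_potential opprK latN addrAC.
Qed.

Lemma equilibrium_potential_equatorial a c : 0 <= c -> c <= a ->
  equilibrium_potential a c = a / 2 * ln 2 + (1 - a) / 2 + xlnx ((1 + a) / 2) +
    (((1 + a) / 2) * circle_log c + ((1 - a) / 2) * circle_log (- c)) / 2.
Proof.
move=> c0 ca; rewrite /equilibrium_potential latitude_potential0// /cap_potential ca.
have -> : - c <= a by lra.
rewrite opprK /xlnx; move: (circle_log c) (circle_log (- c)) (ln _) (ln _) => x y z w.
by field.
Qed.

(** Inside a cap the coefficient of [circle_log c] is a/2 from the ring, -(1 + a)/4 from the cap
    itself and (1 - a)/4 from the opposite cap, which add up to 0. The rim c = a is computed from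
    the equatorial formula. *)
Lemma equilibrium_potential_polar a c : 0 <= a -> a <= c ->
  equilibrium_potential a c = polar_potential a.
Proof.
move=> a0; rewrite le_eqVlt => /predU1P[<-|ac].
  rewrite equilibrium_potential_equatorial// /polar_potential /circle_log /xlnx.
  move: (ln _) (ln _) (ln _) => x y z; by field.
rewrite /equilibrium_potential latitude_potential0 ?(le_trans a0 (ltW ac))//.
rewrite /cap_potential leNgt ac/=.
have -> : - c <= a by lra.
rewrite opprK /polar_potential /xlnx.
move: (circle_log c) (ln _) (ln _) (ln _) => x y z w; by field.
Qed.

Lemma equilibrium_potential_equator a : 0 <= a ->
  equilibrium_potential a 0 = equator_potential a.
Proof.
move=> a0; rewrite equilibrium_potential_equatorial// oppr0 circle_log0.
rewrite /equator_potential; move: (ln _) (xlnx _) => x y; by field.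
Qed.

(** On the belt the excess over the polar value is half the relative entropy of ((1 + a)/2, (1 -
    a)/2) with respect to ((1 + c)/2, (1 - c)/2). *)
Lemma polar_le_equilibrium_potential a c : 0 <= a -> a <= 1 -> -1 <= c <= 1 ->
  polar_potential a <= equilibrium_potential a c.
Proof.
move=> a0 a1 /andP[].
wlog c0 : c / 0 <= c => [hw|_ c1].
  case: (leP 0 c) => [|/ltW c0 c1 c2]; first exact: hw.
  by rewrite -equilibrium_potentialN; apply: hw; lra.
have [ca|/ltW ac] := leP c a; last by rewrite equilibrium_potential_polar.
rewrite equilibrium_potential_equatorial// /polar_potential.
have h1 : (1 + a) / 2 - (1 + c) / 2 <= xlnx ((1 + a) / 2) + (1 + a) / 2 * circle_log c.
  by rewrite /circle_log mulrN; apply: gibbs_inequality; lra.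
have h2 : (1 - a) / 2 - (1 - c) / 2 <= xlnx ((1 - a) / 2) + (1 - a) / 2 * circle_log (- c).
  (* Gibbs' inequality needs a positive reference weight; at c = 1 the bound c <= a forces a = 1,
     and both weights vanish. *)
  have := c1; rewrite le_eqVlt => /predU1P[ce|c1'].
    have -> : a = 1 by lra.
    by rewrite ce /xlnx !subrr !mul0r addr0.
  by rewrite /circle_log mulrN; apply: gibbs_inequality; lra.
move: h1 h2; set x := _ * circle_log c; set y := _ * circle_log (- c) => h1 h2; lra.
Qed.

Definition equilibrium_energy a : R :=
  8^-1 * (- (2 * a) + (a - 1) * ((1 - a) * ln (1 - a) - (a + 1) * ln (1 + a))
          + 2 * a * (a + 1) * ln (1 + a)).

Lemma equilibrium_energyE a : 0 < a -> a <= 1 ->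
  2^-1 * (a * equator_potential a + (1 - a) * polar_potential a - 2^-1) =
  equilibrium_energy a.
Proof.
move=> a0 a1; rewrite /equator_potential /polar_potential /equilibrium_energy /xlnx.
have -> : ln ((1 + a) / 2) = ln (1 + a) - ln 2 by rewrite ln_div ?posrE//; lra.
(* The logarithm of the quotient splits only for a < 1; at a = 1 the prefactor is 0. *)
have e : (1 - a) / 2 * ln ((1 - a) / 2) = (1 - a) / 2 * (ln (1 - a) - ln 2).
  have := a1; rewrite le_eqVlt => /predU1P[->|a1']; first by rewrite subrr !mul0r.
  by rewrite ln_div ?posrE// subr_gt0.
rewrite e; move: (ln (1 + a)) (ln (1 - a)) (ln 2) => x y z; by field.
Qed.

(** Eight times the energy is (1 + a)^2 ln(1 + a) - (1 - a)^2 ln(1 - a) - 2a. Truncating the series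
    of - ln(1 - y) after two terms, at y = a / (1 + a) and at y = a, leaves exactly a^4 / 2. *)
Lemma equilibrium_energy_gt0 a : 0 < a -> a <= 1 -> 0 < equilibrium_energy a.
Proof.
move=> a0 a1; rewrite /equilibrium_energy.
have sum2 (y : R) : \sum_(k < 2) y ^+ k.+1 / k.+1%:R = y + y ^+ 2 / 2.
  by rewrite !big_ord_recl big_ord0/= expr1 divr1 addr0.
have low (y : R) : 0 <= y -> y < 1 -> y + y ^+ 2 / 2 <= - ln (1 - y).
  by move=> y0 y1; have /andP[+ _] := ln_partial_sum_bounds 2 y0 y1; rewrite sum2 subr_ge0.
have ap : 0 < 1 + a by lra.
have h1 : (1 + a) * a + a ^+ 2 / 2 <= (1 + a) ^+ 2 * ln (1 + a).
  have y1 : a / (1 + a) < 1 by rewrite ltr_pdivrMr//; lra.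
  have := low (a / (1 + a)) (divr_ge0 (ltW a0) (ltW ap)) y1.
  have -> : 1 - a / (1 + a) = (1 + a)^-1 by field; rewrite gt_eqF.
  rewrite lnV ?posrE// opprK -(ler_pM2l (exprn_gt0 2 ap)); apply: le_trans.
  rewrite le_eqVlt; apply/orP; left; apply/eqP; by field; rewrite gt_eqF.
have h2 : (1 - a) ^+ 2 * (a + a ^+ 2 / 2) <= - ((1 - a) ^+ 2 * ln (1 - a)).
  have := a1; rewrite le_eqVlt => /predU1P[->|a1'].
    by rewrite subrr expr0n/= !mul0r oppr0.
  by rewrite -mulrN ler_wpM2l ?sqr_ge0// low// ltW.
have h3 : 0 < a ^+ 4 by rewrite exprn_gt0.
rewrite mulr_gt0 ?invr_gt0//.
have -> : - (2 * a) + (a - 1) * ((1 - a) * ln (1 - a) - (a + 1) * ln (1 + a))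
          + 2 * a * (a + 1) * ln (1 + a) =
   (1 + a) ^+ 2 * ln (1 + a) - (1 - a) ^+ 2 * ln (1 - a) - 2 * a by ring.
apply: (lt_le_trans (_ : 0 < a ^+ 4 / 2)); first by rewrite divr_gt0.
have -> : a ^+ 4 / 2 = (1 + a) * a + a ^+ 2 / 2 + (1 - a) ^+ 2 * (a + a ^+ 2 / 2) - 2 * a.
  by field.
lra.
Qed.

End EquilibriumPotential.

(** * The uniform charge on the equator *)

Section RingMeasure.
Context {R : realType}.
Notation mu := (@lebesgue_measure R).
Implicit Types r s : space3 R.
Variables (a : R) (a0 : 0 <= a).

(** Written through [sphere_point] so that [integral_azimuth] at polar angle pi/2 gives the
    potential. *)
Definition ring_point (x : R) : space3 R := sphere_point (x, pi / 2).

Lemma measurable_ring_point : measurable_fun setT ring_point.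
Proof.
apply: (measurableT_comp measurable_sphere_point).
by apply: measurable_fun_pair; [exact: measurable_id|exact: measurable_cst].
Qed.

Lemma equator_ring_point x : equator (ring_point x).
Proof.
split; first exact: sphere_sphere_point.
by rewrite /= cos_pihalf mulr0.
Qed.

Lemma ring_density_ge0 (x : R) : `[0, 2 * pi]%classic x -> 0 <= cst (a / (2 * pi)) x.
Proof. by rewrite /cst divr_ge0// mulr_ge0// pi_ge0. Qed.

Definition ring_measure : {measure set space3 R -> \bar R} :=
  image_density mu measurable_ring_point (measurable_itv `[0, 2 * pi])
    (@measurable_cst _ _ _ _ _ (a / (2 * pi))) ring_density_ge0.

Lemma ring_measure_potential r : sphere r ->
  (\int[ring_measure]_(s in sphere) coulomb r s =
   (a / 2 * latitude_potential (2 * r.2) 0)%:E)%E.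
Proof.
move=> hr; rewrite ge0_integral_image_density; last 4 first.
- exact: measurable_sphere.
- exact: measurable_coulomb.
- by move=> s; exact: coulomb_ge0.
- by move=> x; exact: sphere_sphere_point.
under eq_integral do rewrite muleC.
rewrite ge0_integralZl_EFin//; last 3 first.
- by move=> x _; rewrite coulomb_ge0//; exact: sphere_sphere_point.
- apply: (@measurable_comp _ _ _ _ _ _ sphere) => //.
  + exact: measurable_sphere.
  + by move=> _ [u _ <-]; exact: sphere_sphere_point.
  + exact: measurable_coulomb.
  + by apply: measurable_funTS; exact: measurable_ring_point.
- by rewrite divr_ge0// mulr_ge0// pi_ge0.
rewrite integral_azimuth ?sin_pihalf// cos_pihalf -EFinM; congr EFin.
have : (pi : R) != 0 by rewrite gt_eqF ?pi_gt0.
by move: (pi : R) (latitude_potential _ _) => p q p0; field.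
Qed.

Lemma ring_measureE U : (forall x, U (ring_point x)) -> ring_measure U = a%:E.
Proof.
move=> hU; rewrite /ring_measure/= /image_density (_ : _ `&` _ = `[0, 2 * pi]%classic); last first.
  by apply/seteqP; split => [u []//|u au]; split => //=; exact: hU.
rewrite (@integral_cst _ _ _ mu _ _ (a / (2 * pi))%:E)//.
transitivity ((a / (2 * pi))%:E * (2 * pi)%:E)%E.
  by congr (_ * _)%E; exact: lebesgue_measure_circle.
by rewrite -EFinM divfK// mulf_neq0// gt_eqF// pi_gt0.
Qed.

Lemma ring_measure0 U : (forall x, ~ U (ring_point x)) -> ring_measure U = 0%E.
Proof.
move=> hU; rewrite /ring_measure/= /image_density (_ : _ `&` _ = set0) ?integral_set0//.
by apply/seteqP; split => u // -[au]; exact: hU.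
Qed.

End RingMeasure.

(** * The minimum energy *)

Section MinimumEnergy.
Context {R : realType}.
Implicit Types (r s : space3 R) (m : {measure set space3 R -> \bar R}).

Lemma measurable_equator : measurable (@equator R).
Proof.
apply: measurableI; first exact: measurable_sphere.
rewrite (_ : [set r | _] = (snd : space3 R -> R) @^-1` [set 0]) //.
by rewrite -[X in measurable X]setTI; apply: measurable_snd.
Qed.

Lemma sub_equator_sphere : @equator R `<=` sphere.
Proof. by move=> r []. Qed.

Definition polar_region (a : R) : set (space3 R) := sphere `&` [set r | a <= `|2 * r.2|].

Lemma measurable_polar_region a : measurable (polar_region a).
Proof.
apply: measurableI; first exact: measurable_sphere.
rewrite (_ : [set r | _] = (fun r : space3 R => `|2 * r.2|) @^-1` `[a, +oo[); last first.
  by apply/seteqP; split => r /=; rewrite in_itv/= andbT.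
rewrite -[X in measurable X]setTI.
have : measurable_fun setT (fun r : space3 R => `|2 * r.2|).
  apply: measurableT_comp => //.
  by apply: measurable_funM; [exact: measurable_cst|exact: measurable_snd].
by apply.
Qed.

(** Serves for the self-interaction of the minimiser: each of its two parts is concentrated where
    the potential is constant. *)
Lemma integral_concentrated m (A D : set (space3 R)) (f : space3 R -> \bar R) (k : R) :
  measurable A -> measurable D -> A `<=` D -> m (D `\` A) = 0%E ->
  measurable_fun D f -> (forall x, D x -> (0 <= f x)%E) ->
  (forall x, A x -> f x = k%:E) -> (\int[m]_(x in D) f x = k%:E * m A)%E.
Proof.
move=> mA mD AD mDA mf f0 fk.
have mDA' : measurable (D `\` A) by exact: measurableD.
rewrite (ge0_negligible_integral mDA' mD mf f0 mDA) setDD setIidr//.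
transitivity (\int[m]_(x in A) (cst k%:E) x)%E; last by rewrite integral_cst.
by apply: eq_integral => x; rewrite inE => /fk.
Qed.

Section Minimizer.
Variables (a : R) (a0 : 0 < a) (a1 : a <= 1).

Let a_ge0 : 0 <= a := ltW a0.

Let a_bounds : -1 <= a <= 1.
Proof. by rewrite a1 andbT (le_trans _ a_ge0)// oppr_le0. Qed.

Let caps := measure_add (cap_measure a_bounds false) (cap_measure a_bounds true).

Lemma capsE U : (forall b u, cap_angles a u -> U (mirror_point b u)) ->
  caps U = (1 - a)%:E.
Proof.
move=> hU; rewrite /caps measure_addE !cap_measureE; last 2 first.
- by move=> u; exact: hU.
- by move=> u; exact: hU.
by rewrite -EFinD -splitr.
Qed.

Lemma caps0 U : (forall b u, cap_angles a u -> ~ U (mirror_point b u)) -> caps U = 0%E.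
Proof.
by move=> hU; rewrite /caps measure_addE !cap_measure0 ?adde0// => u; exact: hU.
Qed.

Lemma polar_region_mirror_point b u : cap_angles a u -> polar_region a (mirror_point b u).
Proof.
move=> [_ /=]; rewrite in_itv/= => /andP[u0 ua].
split; first exact: sphere_mirror_point.
suff : a <= `|2 * (mirror_point b u).2| by [].
have -> : `|2 * (mirror_point b u).2| = `|cos u.2|.
  rewrite /mirror_point; case: b => /=; rewrite ?mulrN ?normrN; congr `|_|; by field.
apply: le_trans (ler_norm _).
have -> : a = cos (acos a) by rewrite acosK// in_itv/=.
by apply: cos_antitone => //; rewrite acos_lepi.
Qed.

Lemma minimizer_ex : exists ne nb : {finite_measure set space3 R -> \bar R},
  (forall U, ne U = ring_measure a_ge0 U) /\ (forall U, nb U = caps U).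
Proof.
have [|ne hne] := finite_measure_ex (m := ring_measure a_ge0).
  by rewrite ring_measureE ?ltry.
have [|nb hnb] := finite_measure_ex (m := caps).
  apply: le_lt_trans (ltry (1 - a)); rewrite -(@capsE setT)//; exact: lexx.
by exists ne, nb.
Qed.

Section Potential.
Variables ne nb : {finite_measure set space3 R -> \bar R}.
Hypothesis neE : forall U, ne U = ring_measure a_ge0 U.
Hypothesis nbE : forall U, nb U = caps U.

Lemma minimizer_configuration : charge_configuration a ne nb.
Proof.
split.
- by rewrite neE ring_measure0// => x; apply; exact: equator_ring_point.
- by rewrite neE ring_measureE// => x; exact: equator_ring_point.
- by rewrite nbE caps0// => b u _; apply; exact: sphere_mirror_point.
- by rewrite nbE capsE// => b u _; exact: sphere_mirror_point.
- by move=> U mU; rewrite !nbE /caps !measure_addE !cap_measure_reflect/= addeC.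
Qed.

Lemma minimizer_potential r : sphere r ->
  (\int[measure_add ne nb]_(s in sphere) coulomb r s =
   (equilibrium_potential a (2 * r.2))%:E)%E.
Proof.
move=> hr; have mS := @measurable_sphere R; have mc := measurable_coulomb hr.
have c0 s : sphere s -> (0 <= coulomb r s)%E by exact: coulomb_ge0.
rewrite ge0_integral_measure_add//.
rewrite (@eq_measure_integral _ _ _ sphere (ring_measure a_ge0))//; last first.
  by move=> U _ _; exact: neE.
rewrite (@eq_measure_integral _ _ _ sphere caps nb)//; last first.
  by move=> U _ _; exact: nbE.
rewrite ring_measure_potential// ge0_integral_measure_add//.
rewrite !cap_measure_potential// -!EFinD expr0 expr1 mul1r mulN1r addrA.
by rewrite /equilibrium_potential.
Qed.

End Potential.

Section Configuration.
Variables ne nb : {finite_measure set space3 R -> \bar R}.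
Hypothesis conf : charge_configuration a ne nb.

Lemma configuration_ring_sphere : ne sphere = a%:E.
Proof.
have [h1 h2 _ _ _] := conf.
have mC := measurable_equator; have mS := @measurable_sphere R.
rewrite -(setDUK sub_equator_sphere) measureU//; last 2 first.
- exact: measurableD.
- by rewrite setDIK.
rewrite -[RHS]adde0; congr (_ + _)%E; first exact: h2.
apply: (subset_measure0 _ _ _ h1).
- exact: measurableD.
- exact: measurableC.
- by move=> r [].
Qed.

Lemma configuration_sphere : measure_add ne nb sphere = 1%E.
Proof.
have [_ _ _ h _] := conf.
rewrite measure_addE; transitivity (a%:E + (1 - a)%:E)%E.
  by congr (_ + _)%E; [exact: configuration_ring_sphere|exact: h].
by rewrite -EFinD addrC subrK.
Qed.

Lemma configuration_sphere_fin : (measure_add ne nb sphere < +oo)%E.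
Proof. by rewrite configuration_sphere ltry. Qed.

Lemma background_sphere_fin : (@background R sphere < +oo)%E.
Proof. by rewrite background_sphere ltry. Qed.

Lemma interaction_background m : m sphere = 1%E ->
  interaction m background = (2^-1)%:E.
Proof.
move=> m1; rewrite /interaction.
transitivity (\int[m]_(r in sphere) (cst (2^-1)%:E) r)%E.
  by apply: eq_integral => r; rewrite inE => /background_potential.
by rewrite integral_cst ?m1 ?mule1//; exact: measurable_sphere.
Qed.

(** The total charge is 1 and the background potential is 1/2, so the three background terms are
    -1/2 - 1/2 + 1/2 for every configuration. *)
Lemma configuration_energy :
  energy ne nb = ((2^-1)%:E * (interaction (measure_add ne nb) (measure_add ne nb) - (2^-1)%:E))%E.
Proof.
rewrite /energy (interaction_sym background_sphere_fin configuration_sphere_fin).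
rewrite (interaction_background configuration_sphere).
rewrite (interaction_background background_sphere).
by rewrite -addeA -EFinN -EFinD addNr adde0.
Qed.

End Configuration.

Definition minimum_self_interaction : R :=
  a * equator_potential a + (1 - a) * polar_potential a.

Section Comparison.
Variables ne' nb' : {finite_measure set space3 R -> \bar R}.
Hypothesis neE : forall U, ne' U = ring_measure a_ge0 U.
Hypothesis nbE : forall U, nb' U = caps U.

Let nu' := measure_add ne' nb'.
Let psi r : \bar R := (\int[nu']_(s in sphere) coulomb r s)%E.

Let conf' : charge_configuration a ne' nb' := minimizer_configuration neE nbE.
Let nu'_fin : (nu' sphere < +oo)%E := configuration_sphere_fin conf'.

Let mpsi : measurable_fun sphere psi.
Proof. exact: measurable_potential. Qed.

Let psi0 r : sphere r -> (0 <= psi r)%E.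
Proof. by move=> hr; apply: integral_ge0 => s; exact: coulomb_ge0. Qed.

Let psi_equator r : equator r -> psi r = (equator_potential a)%:E.
Proof.
move=> [hr /= r0]; rewrite /psi minimizer_potential// r0 mulr0.
by rewrite equilibrium_potential_equator.
Qed.

Let psi_polar r : polar_region a r -> psi r = (polar_potential a)%:E.
Proof.
move=> [hr /= ar]; rewrite /psi minimizer_potential//; congr EFin.
case: (leP 0 (2 * r.2)) ar => [r0|r0]; first by rewrite ger0_norm//; exact: equilibrium_potential_polar.
by rewrite ltr0_norm// -equilibrium_potentialN; exact: equilibrium_potential_polar.
Qed.

Lemma minimizer_self_interaction : interaction nu' nu' = minimum_self_interaction%:E.
Proof.
have mS := @measurable_sphere R.
rewrite /interaction -/psi ge0_integral_measure_add//.
have -> : (\int[ne']_(r in sphere) psi r = (equator_potential a)%:E * ne' equator)%E.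
  apply: (integral_concentrated measurable_equator mS sub_equator_sphere) => //.
  apply: etrans (neE _) _.
  by rewrite ring_measure0// => x [_]; apply; exact: equator_ring_point.
have -> : (\int[nb']_(r in sphere) psi r = (polar_potential a)%:E * nb' (polar_region a))%E.
  apply: (integral_concentrated (measurable_polar_region a) mS) => //.
    by move=> r [].
  apply: etrans (nbE _) _.
  by apply: caps0 => b u au [_]; apply; exact: polar_region_mirror_point.
transitivity ((equator_potential a)%:E * a%:E + (polar_potential a)%:E * (1 - a)%:E)%E.
  congr (_ * _ + _ * _)%E.
    by apply: etrans (neE _) _; rewrite ring_measureE//; exact: equator_ring_point.
  by apply: etrans (nbE _) _; apply: capsE; exact: polar_region_mirror_point.
rewrite -!EFinM -EFinD /minimum_self_interaction.
by congr EFin; congr (_ + _); rewrite mulrC.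
Qed.

Lemma polar_potential_ge0 : 0 <= polar_potential a.
Proof.
(* The north pole belongs to [polar_region], so the constant is a value of a potential with
   nonnegative kernel. *)
have hr : sphere (0, 0, 2^-1 : R) by apply/sphereE => /=; field.
rewrite -lee_fin -(@psi_polar (0, 0, 2^-1)); first exact: psi0.
by split => //=; rewrite divff ?normr1.
Qed.

(** The charge [ne] meets the potential only on the equator, where it is constant, while [nb] may
    lie anywhere and meets at least the polar value. *)
Lemma mixed_interaction_ge ne nb : charge_configuration a ne nb ->
  (minimum_self_interaction%:E <= interaction (measure_add ne nb) nu')%E.
Proof.
move=> conf; have mS := @measurable_sphere R.
have [_ h2 _ h4 _] := conf.
rewrite /interaction -/psi ge0_integral_measure_add// /minimum_self_interaction EFinD.
apply: leeD.
  apply: (@le_trans _ _ (\int[ne]_(r in equator) psi r)%E); last first.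
    by apply: ge0_subset_integral => //; [exact: measurable_equator|exact: sub_equator_sphere].
  rewrite (@eq_integral _ _ _ _ _ (cst (equator_potential a)%:E)); last first.
    by move=> r; rewrite inE => /psi_equator.
  rewrite integral_cst; last exact: measurable_equator.
  have h2' : (ne : {measure set space3 R -> \bar R}) equator = a%:E := h2.
  by rewrite h2' -EFinM mulrC.
apply: (@le_trans _ _ (\int[nb]_(r in sphere) (cst (polar_potential a)%:E) r)%E).
  have h4' : (nb : {measure set space3 R -> \bar R}) sphere = (1 - a)%:E := h4.
  by rewrite integral_cst// h4' -EFinM mulrC.
apply: ge0_le_integral => //.
- by move=> r _; rewrite lee_fin polar_potential_ge0.
- move=> r hr; rewrite /psi minimizer_potential// lee_fin.
  by apply: polar_le_equilibrium_potential => //; exact: sphere_height.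
Qed.

(** Twice the mixed bound combined with positive definiteness; one copy of the finite
    [minimum_self_interaction] is cancelled, which remains valid when the other self-interaction is
    +oo. *)
Lemma self_interaction_ge ne nb : charge_configuration a ne nb ->
  (minimum_self_interaction%:E <= interaction (measure_add ne nb) (measure_add ne nb))%E.
Proof.
move=> conf; have h := mixed_interaction_ge conf.
have := interaction_positive_definite (configuration_sphere_fin conf) nu'_fin.
rewrite minimizer_self_interaction => hpd.
have := le_trans (leeD h h) hpd.
by rewrite leeD2rE.
Qed.

End Comparison.

Lemma min_energyE : min_energy a = equilibrium_energy a.
Proof.
have [ne' [nb' [neE nbE]]] := minimizer_ex.
have conf' := minimizer_configuration neE nbE.
rewrite -equilibrium_energyE// -/minimum_self_interaction.
set e := 2^-1 * _.
have mem_e : finite_energies a e.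
  exists ne', nb'; split=> //.
  by rewrite configuration_energy// minimizer_self_interaction// -EFinB -EFinM.
have lb_e : lbound (finite_energies a) e.
  move=> x [ne [nb [conf hx]]]; rewrite -lee_fin -hx configuration_energy//.
  rewrite /e EFinM lee_pmul2l// EFinB leeD2r//.
  exact: (self_interaction_ge neE nbE conf).
apply: xget_unique; first by split.
by move=> y [ye yl]; apply/eqP; rewrite eq_le lb_e// yl.
Qed.

End Minimizer.
End MinimumEnergy.

Theorem proposition1 (R : realType)
    (d : nat -> measure_display) (T : forall N : nat, measurableType (d N))
    (P : forall N : nat, probability (T N) R)
    (X : forall N : nat, T N -> 'M[R]_N)
    (hX : forall N : nat, real_spherical_ensemble (P N) (X N))
    (alpha : R) (alpha_gt0 : 0 < alpha) (alpha_le1 : alpha <= 1)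
    (electrostatics :
      - (N%:R ^+ 2)^-1 *
        ln (prob_real_eigenvalues (P N) (X N) (Num.truncn (alpha * N%:R)))
        @[N --> within (admissible alpha) \oo] --> min_energy alpha) :
  ln (prob_real_eigenvalues (P N) (X N) (Num.truncn (alpha * N%:R))) /
  (- (N%:R ^+ 2 / 8) *
    (- (2 * alpha)
     + (alpha - 1) * ((1 - alpha) * ln (1 - alpha)
                      - (alpha + 1) * ln (1 + alpha))
     + 2 * alpha * (alpha + 1) * ln (1 + alpha)))
  @[N --> within (admissible alpha) \oo] --> (1 : R).
Proof.
move: electrostatics; rewrite min_energyE//.
(* Convergence to the limit yields ratio 1 only because the limit is nonzero. *)
have E0 := lt0r_neq0 (equilibrium_energy_gt0 alpha_gt0 alpha_le1).
move=> electrostatics.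
(* The ratio in the conclusion is the sequence of the hypothesis divided by its limit. The identity
   holds for every N: at N = 0 both sides are 0, the inverse of 0 being 0. *)
have key (N : nat) (L : R) : - (N%:R ^+ 2)^-1 * L / equilibrium_energy alpha =
    L / (- (N%:R ^+ 2 / 8) *
      (- (2 * alpha)
       + (alpha - 1) * ((1 - alpha) * ln (1 - alpha)
                        - (alpha + 1) * ln (1 + alpha))
       + 2 * alpha * (alpha + 1) * ln (1 + alpha))).
  rewrite /equilibrium_energy; set F := _ + _; set n := N%:R ^+ 2.
  have -> : - (n / 8) * F = - n * (8^-1 * F) by rewrite !mulNr !mulrA.
  by rewrite (invfM (- n)) invrN mulrA [L * _]mulrC.
have e : equilibrium_energy alpha / equilibrium_energy alpha = 1 := divff E0.
apply: (@cvg_trans _ ((fun N : nat => - (N%:R ^+ 2)^-1 *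
    ln (prob_real_eigenvalues (P N) (X N) (Num.truncn (alpha * N%:R))) /
    equilibrium_energy alpha) @ within (admissible alpha) \oo)).
  by apply: near_eq_cvg; apply: nearW => N; exact: key.
rewrite -[X in _ `=>` nbhs X]e.
by apply: cvgM; [exact: electrostatics|exact: cvg_cst].
Qed.
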